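(* Let $f : (\mathbb{C}^2, \boldsymbol{0}) \to (\mathbb{C}, 0)$ be a germ of a holomorphic function defining a plane branch (an irreducible plane curve singularity) with exactly one characteristic exponent (equivalently, a single Puiseux pair $(n,m)$). Let $\mu$ and $\tau$ be the Milnor number and the Tjurina number of $f$. Then $\mu/\tau < 4/3$.
   Context: For a germ $f : (\mathbb{C}^2, \boldsymbol{0}) \to (\mathbb{C}, 0)$ of a holomorphic function defining an isolated plane curve singularity, the Milnor number and the Tjurina number are $$\mu := \dim_{\mathbb{C}} \frac{\mathbb{C}\{x,y\}}{(\partial f/\partial x, \partial f/\partial y)}, \qquad \tau := \dim_{\mathbb{C}} \frac{\mathbb{C}\{x,y\}}{(f, \partial f/\partial x, \partial f/\partial y)}.$$ A plane branch has a single Puiseux pair $(n,m)$, where $2 \le n < m$ and $\gcd(n,m)=1$, when its semigroup (the set of intersection multiplicities at the origin of $f$ with germs $h \in \mathbb{C}\{x,y\}$ not divisible by $f$) is $\Gamma = \langle n, m\rangle$. *)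

(* Defs.v *)
From HB Require Import structures.
From mathcomp Require Import all_boot all_order all_algebra.
From mathcomp Require Import complex finmap.
From mathcomp Require Import all_classical all_reals ereal esum.

Set Implicit Arguments.
Unset Strict Implicit.
Unset Printing Implicit Defensive.

Import Order.TTheory GRing.Theory Num.Theory.
Import ComplexField.Normc.

Local Open Scope ring_scope.
Local Open Scope complex_scope.
Local Open Scope classical_set_scope.

(* [a i j] is the coefficient of x^i y^j.  The alias keeps the Cauchy product
   apart from the pointwise product that functions carry by default. *)
Definition fps2 (K : comNzRingType) : Type := nat -> nat -> K.

Section FormalPowerSeries.
Variable K : comNzRingType.
Local Notation F := (fps2 K).
Implicit Types a b c : F.

HB.instance Definition _ := Choice.copy F (nat -> nat -> K).

Definition fps2_zero : F := fun _ _ => 0.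
Definition fps2_opp a : F := fun i j => - a i j.
Definition fps2_add a b : F := fun i j => a i j + b i j.
Definition fps2_one : F := fun i j => ((i == 0%N) && (j == 0%N))%:R.
Definition fps2_mul a b : F := fun i j =>
  \sum_(k < i.+1) \sum_(l < j.+1) a k l * b (i - k)%N (j - l)%N.
Definition fps2_scale (z : K) a : F := fun i j => z * a i j.

Lemma fps2P a b : (forall i j, a i j = b i j) -> a = b.
Proof. by move=> ab; apply/funext => i; apply/funext => j. Qed.

Fact fps2_addA : associative fps2_add.
Proof. by move=> a b c; apply: fps2P => i j; exact: addrA. Qed.
Fact fps2_addC : commutative fps2_add.
Proof. by move=> a b; apply: fps2P => i j; exact: addrC. Qed.
Fact fps2_add0 : left_id fps2_zero fps2_add.
Proof. by move=> a; apply: fps2P => i j; exact: add0r. Qed.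
Fact fps2_addN : left_inverse fps2_zero fps2_opp fps2_add.
Proof. by move=> a; apply: fps2P => i j; exact: addNr. Qed.

HB.instance Definition _ :=
  GRing.isZmodule.Build F fps2_addA fps2_addC fps2_add0 fps2_addN.

Definition fps2_trunc (N : nat) a : {poly {poly K}} :=
  \poly_(i < N) \poly_(j < N) a i j.

Lemma coef_fps2_trunc N a i j : (i < N)%N -> (j < N)%N ->
  (fps2_trunc N a)`_i`_j = a i j.
Proof. by move=> iN jN; rewrite coef_poly iN coef_poly jN. Qed.

Lemma fps2_mul_agree N (p q : {poly {poly K}}) a b :
  (forall i j, (i < N)%N -> (j < N)%N -> p`_i`_j = a i j) ->
  (forall i j, (i < N)%N -> (j < N)%N -> q`_i`_j = b i j) ->
  forall i j, (i < N)%N -> (j < N)%N -> (p * q)`_i`_j = fps2_mul a b i j.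
Proof.
move=> pa qb i j iN jN; rewrite coefM coef_sum; apply: eq_bigr => k _.
rewrite coefM; apply: eq_bigr => l _.
rewrite pa ?qb ?(leq_ltn_trans (leq_subr _ _)) //.
- exact: leq_ltn_trans (leq_ord k) iN.
- exact: leq_ltn_trans (leq_ord l) jN.
Qed.

Fact fps2_mulA : associative fps2_mul.
Proof.
move=> a b c; apply: fps2P => i j; pose N := (i + j).+1.
have iN : (i < N)%N by rewrite ltnS leq_addr.
have jN : (j < N)%N by rewrite ltnS leq_addl.
pose T := @coef_fps2_trunc N.
rewrite -(fps2_mul_agree (T a) (fps2_mul_agree (T b) (T c)) iN jN) mulrA.
exact: (fps2_mul_agree (fps2_mul_agree (T a) (T b)) (T c) iN jN).
Qed.

Fact fps2_mulC : commutative fps2_mul.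
Proof.
move=> a b; apply: fps2P => i j; pose N := (i + j).+1.
have iN : (i < N)%N by rewrite ltnS leq_addr.
have jN : (j < N)%N by rewrite ltnS leq_addl.
pose T := @coef_fps2_trunc N.
by rewrite -(fps2_mul_agree (T a) (T b) iN jN) mulrC
   (fps2_mul_agree (T b) (T a) iN jN).
Qed.

Fact fps2_mul1 : left_id fps2_one fps2_mul.
Proof.
move=> a; apply: fps2P => i j.
rewrite /fps2_mul big_ord_recl [X in _ + X]big1 => [|k _]; last first.
  by rewrite big1 // => l _; rewrite mul0r.
rewrite addr0 big_ord_recl [X in _ + X]big1 => [|l _]; last by rewrite mul0r.
by rewrite addr0 mul1r !subn0.
Qed.

Fact fps2_mulD : left_distributive fps2_mul +%R.
Proof.
move=> a b c; apply: fps2P => i j.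
rewrite [RHS]/GRing.add /= /fps2_add /fps2_mul -big_split.
apply: eq_bigr => k _; rewrite -big_split; apply: eq_bigr => l _.
exact: mulrDl.
Qed.

Fact fps2_one_neq0 : fps2_one != 0.
Proof.
by apply/eqP => /(congr1 (fun a : F => a 0%N 0%N)) /eqP; rewrite oner_eq0.
Qed.

HB.instance Definition _ := GRing.Zmodule_isComNzRing.Build F
  fps2_mulA fps2_mulC fps2_mul1 fps2_mulD fps2_one_neq0.

Fact fps2_scaleA (z t : K) a :
  fps2_scale z (fps2_scale t a) = fps2_scale (z * t) a.
Proof. by apply: fps2P => i j; exact: mulrA. Qed.
Fact fps2_scale1 : left_id 1 fps2_scale.
Proof. by move=> a; apply: fps2P => i j; exact: mul1r. Qed.
Fact fps2_scaleDr : right_distributive fps2_scale +%R.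
Proof. by move=> z a b; apply: fps2P => i j; exact: mulrDr. Qed.
Fact fps2_scaleDl a : {morph fps2_scale^~ a : z t / z + t}.
Proof. by move=> z t; apply: fps2P => i j; exact: mulrDl. Qed.

HB.instance Definition _ := GRing.Zmodule_isLmodule.Build K F
  fps2_scaleA fps2_scale1 fps2_scaleDr fps2_scaleDl.

Fact fps2_scaleAl (z : K) a b : z *: (a * b) = (z *: a) * b.
Proof.
apply: fps2P => i j; rewrite [LHS]mulr_sumr; apply: eq_bigr => k _.
by rewrite mulr_sumr; apply: eq_bigr => l _; rewrite mulrA.
Qed.

HB.instance Definition _ := GRing.Lmodule_isLalgebra.Build K F fps2_scaleAl.
HB.instance Definition _ := GRing.Lalgebra_isComAlgebra.Build K F.

Lemma fps2_mulE a b i j : (a * b) i j =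
  \sum_(k < i.+1) \sum_(l < j.+1) a k l * b (i - k)%N (j - l)%N.
Proof. by []. Qed.

Definition fps2_dx a : F := fun i j => a i.+1 j *+ i.+1.
Definition fps2_dy a : F := fun i j => a i j.+1 *+ j.+1.

End FormalPowerSeries.

Section Convergence.
Variable R : realType.
Implicit Types a b : fps2 R[i].

Definition fps2_summable (r : R) a : Prop :=
  summable [set: nat * nat]
    (fun k => (normc (a k.1 k.2) * r ^+ (k.1 + k.2))%:E).

Definition fps2_bounded (r M : R) a : Prop := forall N,
  \sum_(i < N) \sum_(j < N) normc (a i j) * r ^+ (i + j) <= M.

Lemma normc_ge0 (z : R[i]) : 0 <= normc z.
Proof. by case: z => u v; exact: sqrtr_ge0. Qed.

Lemma normcD (z t : R[i]) : normc (z + t) <= normc z + normc t.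
Proof. by have := ler_normD z t; rewrite -rmorphD lecR. Qed.

Lemma normc_sum I (s : seq I) (P : pred I) (z : I -> R[i]) :
  normc (\sum_(i <- s | P i) z i) <= \sum_(i <- s | P i) normc (z i).
Proof.
elim/big_ind2: _ => [|u u' v v' uu' vv'|//]; first by rewrite normc0.
by rewrite (le_trans (normcD _ _)) ?lerD.
Qed.

Lemma fps2_summableP (r : R) a : 0 < r ->
  fps2_summable r a <-> exists M, fps2_bounded r M a.
Proof.
move=> r0; pose t k : R := normc (a k.1 k.2) * r ^+ (k.1 + k.2).
have t0 k : 0 <= t k by rewrite mulr_ge0 ?normc_ge0 ?exprn_ge0 ?(ltW r0).
have tE : (fun k => `|(t k)%:E|)%E = (fun k => (t k)%:E).
  by apply/funext => k; rewrite gee0_abs ?lee_fin.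
pose box N := [seq (i, j) | i <- index_iota 0 N, j <- index_iota 0 N].
have box_uniq N : uniq (box N).
  by apply: allpairs_uniq; rewrite ?iota_uniq // => -[? ?] [? ?].
have boxE N : \sum_(i < N) \sum_(j < N) normc (a i j) * r ^+ (i + j)
    = \sum_(k <- box N) t k.
  rewrite /box big_allpairs_dep big_mkord; apply: eq_bigr => i _.
  by rewrite big_mkord.
rewrite /fps2_summable /summable tE; split=> [S|[M bM]].
  exists (fine (\esum_(k in [set: nat * nat]) (t k)%:E)) => N.
  rewrite boxE -lee_fin fineK; last first.
    by rewrite ge0_fin_numE ?esum_ge0 // => k _; rewrite lee_fin.
  apply: esum_ge; exists [set` box N]; first by split => //; exact: finite_seq.
  by rewrite -fsbig_seq //= -sumEFin.
apply: (@le_lt_trans _ _ M%:E); last by rewrite ltry.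
apply: ub_ereal_sup => _ [A [finA _]] <-.
pose s := fset_set A.
pose N := (\max_(k <- s) (k.1 + k.2))%N.+1.
apply: (@le_trans _ _ (\sum_(k \in [set` box N]) (t k)%:E)%E); last first.
  have -> : (\sum_(k \in [set` box N]) (t k)%:E)%E = (\sum_(k <- box N) t k)%:E.
    by rewrite -fsbig_seq // -sumEFin.
  by rewrite lee_fin -boxE.
apply: lee_fsum_nneg_subset => //; first exact: finite_seq.
  move=> k; rewrite !inE => Ak /=.
  have ks : k \in (s : seq _) by rewrite /s in_fset_set // inE.
  have kN : (k.1 + k.2 < N)%N.
    by rewrite ltnS; apply: (leq_bigmax_seq (F := fun k => k.1 + k.2)%N).
  case: k kN {Ak ks} => i j /= kN; apply/allpairsP; exists (i, j); split=> //=;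
  by rewrite mem_index_iota (leq_ltn_trans _ kN) ?leq_addl ?leq_addr.
by move=> k _; rewrite lee_fin.
Qed.

(* Absolute convergence at (r, r), hence on the bidisc |x|, |y| <= r. *)
Definition convergent2 : {pred fps2 R[i]} :=
  fun a => `[< exists2 r : R, 0 < r & fps2_summable r a >].

Lemma convergent2P a : reflect
  (exists2 r : R, 0 < r & exists M, fps2_bounded r M a) (a \in convergent2).
Proof.
by apply: (iffP (asboolP _)) => -[r r0 H]; exists r => //; apply/fps2_summableP.
Qed.

Lemma fps2_bounded_le (r s M : R) a :
  0 <= s -> s <= r -> fps2_bounded r M a -> fps2_bounded s M a.
Proof.
move=> s0 sr H N; apply: le_trans (H N).
apply: ler_sum => i _; apply: ler_sum => j _.
by rewrite ler_wpM2l ?normc_ge0 // lerXn2r ?nnegrE // (le_trans s0).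
Qed.

Lemma convergent2_pair a b : a \in convergent2 -> b \in convergent2 ->
  exists2 r : R, 0 < r & exists M P, fps2_bounded r M a /\ fps2_bounded r P b.
Proof.
move=> /convergent2P[r r0 [M HM]] /convergent2P[s s0 [P HP]].
have m0 : 0 < Num.min r s by rewrite lt_min r0.
exists (Num.min r s) => //; exists M, P; split.
  by apply: fps2_bounded_le (ltW m0) _ HM; rewrite ge_min lexx.
by apply: fps2_bounded_le (ltW m0) _ HP; rewrite ge_min lexx orbT.
Qed.

Lemma le_sum_ord_support n N (u : nat -> R) : (forall i, 0 <= u i) ->
  (forall i, (n <= i)%N -> u i = 0) -> \sum_(i < N) u i <= \sum_(i < n) u i.
Proof.
move=> u0 un; case: (leqP N n) => [le|/ltnW le]; rewrite (big_ord_widen _ u le).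
  rewrite [leRHS](bigID (fun i : 'I_n => (i < N)%N)) /=.
  by rewrite lerDl sumr_ge0.
rewrite [leLHS](bigID (fun i : 'I_N => (i < n)%N)) /= gerDl big1 // => i.
by rewrite -leqNgt; exact: un.
Qed.

Lemma fps2_bounded_mul (r M P : R) a b : 0 < r ->
  fps2_bounded r M a -> fps2_bounded r P b -> fps2_bounded r (M * P) (a * b).
Proof.
move=> r0 HM HP N.
have r1 n : 0 <= r ^+ n by rewrite exprn_ge0 ?(ltW r0).
pose na : fps2 R := fun i j => normc (a i j).
pose nb : fps2 R := fun i j => normc (b i j).
pose p := fps2_trunc N na; pose q := fps2_trunc N nb.
have val (c : fps2 R) : (fps2_trunc N c).[r%:P].[r] =
    \sum_(i < N) \sum_(j < N) c i j * r ^+ (i + j).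
  rewrite horner_poly horner_sum; apply: eq_bigr => i _.
  rewrite hornerM horner_poly -polyC_exp hornerC mulr_suml.
  by apply: eq_bigr => j _; rewrite exprD mulrA mulrAC.
have pos (c : fps2 R) : (forall i j, 0 <= c i j) ->
    forall i j, 0 <= (fps2_trunc N c)`_i`_j.
  move=> c0 i j; rewrite coef_poly; case: ifP => _; last by rewrite coef0.
  by rewrite coef_poly; case: ifP.
have pq0 i j : 0 <= (p * q)`_i`_j.
  rewrite coefM coef_sum sumr_ge0 // => k _; rewrite coefM sumr_ge0 // => l _.
  by rewrite mulr_ge0 ?pos // => *; rewrite normc_ge0.
apply: (@le_trans _ _ ((p * q).[r%:P].[r])); last first.
  rewrite !hornerM; apply: ler_pM; rewrite ?val; try exact: HM; try exact: HP.
    by do 2!(apply: sumr_ge0 => ? _); rewrite mulr_ge0 ?normc_ge0.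
  by do 2!(apply: sumr_ge0 => ? _); rewrite mulr_ge0 ?normc_ge0.
apply: (@le_trans _ _ (\sum_(i < N) \sum_(j < N) (p * q)`_i`_j * r ^+ (i + j))).
  apply: ler_sum => i _; apply: ler_sum => j _; rewrite ler_wpM2r //.
  rewrite (@fps2_mul_agree _ N _ _ na nb) //; last first.
  - exact: coef_fps2_trunc.
  - exact: coef_fps2_trunc.
  apply: le_trans (normc_sum _ _ _) _; apply: ler_sum => k _.
  apply: le_trans (normc_sum _ _ _) _; apply: ler_sum => l _.
  by rewrite normcM.
set S := size (p * q).
have tail (i : nat) : \sum_(j < N) (p * q)`_i`_j * r ^+ (i + j) <=
    ((p * q)`_i).[r] * r ^+ i.
  rewrite horner_coef mulr_suml.
  under [leRHS]eq_bigr do rewrite -mulrA -exprD addnC.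
  apply: (@le_sum_ord_support _ _ (fun j => (p * q)`_i`_j * r ^+ (i + j))).
    by move=> j; rewrite mulr_ge0.
  by move=> j sj; rewrite nth_default ?mul0r.
apply: (@le_trans _ _ (\sum_(i < N) ((p * q)`_i).[r] * r ^+ i)).
  by apply: ler_sum => i _.
rewrite [leRHS](_ : _ = \sum_(i < S) ((p * q)`_i).[r] * r ^+ i); last first.
  rewrite (horner_coef (p * q)) horner_sum; apply: eq_bigr => i _.
  by rewrite hornerM -polyC_exp hornerC.
apply: (@le_sum_ord_support _ _ (fun i => ((p * q)`_i).[r] * r ^+ i)).
  move=> i; rewrite horner_coef mulr_ge0 // sumr_ge0 // => j _.
  by rewrite mulr_ge0.
by move=> i si; rewrite nth_default ?horner0 ?mul0r.
Qed.

Lemma fps2_bounded_swap (r M : R) a :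
  fps2_bounded r M a -> fps2_bounded r M (fun i j => a j i).
Proof.
move=> H N; rewrite exchange_big; apply: le_trans (H N).
by apply: ler_sum => i _; apply: ler_sum => j _; rewrite addnC.
Qed.

Fact convergent2_dx a : a \in convergent2 -> fps2_dx a \in convergent2.
Proof.
move=> /convergent2P[r r0 [M H]].
have r20 : 0 < r / 2 by rewrite divr_gt0.
apply/convergent2P; exists (r / 2) => //; exists (r^-1 * M) => N.
have t0 i j : 0 <= normc (a i j) * r ^+ (i + j).
  by rewrite mulr_ge0 ?normc_ge0 ?exprn_ge0 ?(ltW r0).
apply: le_trans (_ : r^-1 * \sum_(i < N.+1) \sum_(j < N.+1)
    normc (a i j) * r ^+ (i + j) <= _); last first.
  by rewrite ler_wpM2l ?invr_ge0 ?(ltW r0).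
rewrite big_ord_recl mulrDr -[leLHS]add0r lerD //.
  by rewrite mulr_ge0 ?invr_ge0 ?(ltW r0) // sumr_ge0.
rewrite mulr_sumr; apply: ler_sum => i _.
rewrite big_ord_recr mulrDr -[leLHS]addr0 lerD //; last first.
  by rewrite mulr_ge0 ?invr_ge0 ?(ltW r0).
rewrite mulr_sumr; apply: ler_sum => j _.
rewrite lift0 /fps2_dx. rewrite -[a _ _ *+ _]mulr_natr normcM.
have -> : normc (i.+1%:R : R[i]) = i.+1%:R.
  have : `|i.+1%:R : R[i]| = i.+1%:R by rewrite normr_nat.
  by rewrite -[in RHS](rmorph_nat (real_complex R)) => -[].
rewrite addSn exprS mulrCA mulKf ?gt_eqF // -mulrA ler_wpM2l ?normc_ge0 //.
rewrite expr_div_n mulrCA -[leRHS]mulr1 ler_wpM2l ?exprn_ge0 ?(ltW r0) //.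
rewrite ler_pdivrMr ?exprn_gt0 // mul1r -natrX ler_nat.
by rewrite (leq_trans (ltn_expl i (ltnSn 1))) // leq_exp2l // leq_addr.
Qed.

Lemma convergent2_swap a :
  a \in convergent2 -> (fun i j => a j i : R[i]) \in convergent2.
Proof.
move=> /convergent2P[r r0 [M H]]; apply/convergent2P; exists r => //.
by exists M; exact: fps2_bounded_swap.
Qed.

Fact convergent2_dy a : a \in convergent2 -> fps2_dy a \in convergent2.
Proof. by move=> /convergent2_swap/convergent2_dx/convergent2_swap. Qed.

Fact convergent2_subalg : subalg_closed convergent2.
Proof.
split=> [|z a b /convergent2_pair H /H|a b /convergent2_pair H /H].
- apply/convergent2P; exists 1 => //; exists 1 => N.
  case: N => [|N]; first by rewrite big_ord0.
  rewrite big_ord_recl [X in _ + X]big1 => [|k _]; last first.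
    by rewrite big1 // => l _; rewrite normc0 mul0r.
  rewrite addr0 big_ord_recl [X in _ + X]big1 => [|l _]; last first.
    by rewrite normc0 mul0r.
  by rewrite addr0 normc1 mul1r expr1n.
- move=> [r r0 [M [P [HM HP]]]]; apply/convergent2P; exists r => //.
  exists (normc z * M + P) => N.
  apply: le_trans (_ : normc z * (\sum_(i < N) \sum_(j < N)
     normc (a i j) * r ^+ (i + j)) + (\sum_(i < N) \sum_(j < N)
     normc (b i j) * r ^+ (i + j)) <= _); last first.
    by rewrite lerD ?HP // ler_wpM2l ?normc_ge0.
  rewrite mulr_sumr -big_split; apply: ler_sum => i _.
  rewrite mulr_sumr -big_split; apply: ler_sum => j _.
  rewrite /= mulrA -mulrDl ler_wpM2r ?exprn_ge0 ?(ltW r0) //.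
  by rewrite -normcM normcD.
- move=> [r r0 [M [P [HM HP]]]]; apply/convergent2P; exists r => //.
  by exists (M * P); exact: fps2_bounded_mul.
Qed.

HB.instance Definition _ :=
  GRing.isSubalgClosed.Build R[i] (fps2 R[i]) convergent2 convergent2_subalg.

End Convergence.

(* Germs at 0 of holomorphic functions of two variables, given by their Taylor
   series. *)
Record germ2 (R : realType) := Germ2 {
  germ2_fps :> fps2 R[i];
  germ2P : germ2_fps \in @convergent2 R }.

Section Germs.
Variable R : realType.

HB.instance Definition _ := [isSub for @germ2_fps R].
HB.instance Definition _ := [Choice of germ2 R by <:].
HB.instance Definition _ := [SubChoice_isSubComNzRing of germ2 R by <:].
HB.instance Definition _ := [SubZmodule_isSubLmodule of germ2 R by <:].
HB.instance Definition _ :=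
  [SubNzRing_SubLmodule_isSubLalgebra of germ2 R by <:].
HB.instance Definition _ := GRing.Lalgebra_isComAlgebra.Build R[i] (germ2 R).

Definition germ2_unit : {pred germ2 R} := fun f => `[< exists g, g * f = 1 >].

Definition germ2_inv (f : germ2 R) : germ2 R :=
  if pselect (exists g, g * f = 1) is left e then projT1 (cid e) else f.

Fact germ2_mulVx : {in germ2_unit, left_inverse 1 germ2_inv *%R}.
Proof.
move=> f /asboolP e; rewrite /germ2_inv; case: pselect => // e'.
exact: (projT2 (cid e')).
Qed.
Fact germ2_unitPl (f g : germ2 R) : g * f = 1 -> germ2_unit f.
Proof. by move=> e; apply/asboolP; exists g. Qed.
Fact germ2_invr_out : {in [predC germ2_unit], germ2_inv =1 id}.
Proof.
by move=> f /asboolP e; rewrite /germ2_inv; case: pselect => // e'.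
Qed.

HB.instance Definition _ := GRing.ComNzRing_hasMulInverse.Build (germ2 R)
  germ2_mulVx germ2_unitPl germ2_invr_out.

Definition dx (f : germ2 R) : germ2 R := Germ2 (convergent2_dx (germ2P f)).
Definition dy (f : germ2 R) : germ2 R := Germ2 (convergent2_dy (germ2P f)).

Definition at0 (f : germ2 R) : R[i] := germ2_fps f 0%N 0%N.

End Germs.

Definition gen_ideal (A : comNzRingType) (s : seq A) : set A :=
  [set g | exists c : nat -> A, g = \sum_(i < size s) c i * s`_i].

(* [dim_K (A / I) = d]: the classes of some [b_0, ..., b_(d-1)] form a basis of
   the [K]-vector space [A / I].  No [d] works if [A / I] has infinite
   dimension. *)
Definition quot_dim (K : fieldType) (A : lmodType K) (I : set A) (d : nat) :
    Prop :=
  exists b : 'I_d -> A, forall g : A,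
    exists! c : {ffun 'I_d -> K}, I (g - \sum_(i < d) c i *: b i).

Definition divides (A : comNzRingType) (f g : A) : Prop :=
  exists h, g = h * f.

Definition irreducible_elt (A : comUnitRingType) (f : A) : Prop :=
  [/\ f != 0, f \isn't a GRing.unit &
      forall g h : A, f = g * h -> g \is a GRing.unit \/ h \is a GRing.unit].

Section PlaneCurves.
Variable R : realType.
Implicit Types f h : germ2 R.

Definition plane_branch f : Prop :=
  [/\ at0 f = 0, at0 (dx f) = 0, at0 (dy f) = 0 & irreducible_elt f].

Definition milnor_number f (mu : nat) : Prop :=
  quot_dim (gen_ideal [:: dx f; dy f]) mu.

Definition tjurina_number f (tau : nat) : Prop :=
  quot_dim (gen_ideal [:: f; dx f; dy f]) tau.

Definition intersection_multiplicity f h (k : nat) : Prop :=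
  quot_dim (gen_ideal [:: f; h]) k.

Definition semigroup_of f : set nat :=
  [set k | exists2 h, ~ divides f h & intersection_multiplicity f h k].

Definition single_puiseux_pair f (n m : nat) : Prop :=
  [/\ (2 <= n < m)%N, coprime n m &
      semigroup_of f = [set k | exists u v : nat, k = (u * n + v * m)%N]].

End PlaneCurves.

(* Main.v *)
(* Give x and y the weights n and m.  Irreducibility forces the Newton polygon of
   f to be a single edge: a lattice point splitting it would, by a Hensel-type
   fixed point argument in convergent series, yield a factorization of f.
   Shifting y by multiples of powers of x then brings f, using only the values
   that occur in the semigroup, to the form a y^n + b x^m + (terms of weight
   > nm).  Hence O/(f_x, f_y) is spanned by the monomials x^i y^j with i < m - 1
   and j < n - 1, so mu <= (n - 1)(m - 1).  By Euler's relation f has weight > nm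
   modulo (f_x, f_y); splitting the multipliers of f at a weight k therefore gives
   tau >= (n - 1)(m - 1) - #{weight < k} - #{box monomials of weight > k + nm}.
   For k about nm/2 - n - m both sets have at most as many elements as
   H = {(a, b) : a, b >= 1, 2(na + mb) < nm}, and 8 #H < (n - 1)(m - 1) since H
   and its mirror image are disjoint in a box of a quarter of the area. *)

Require Import Defs.
From mathcomp Require Import all_boot all_order all_algebra.
From mathcomp Require Import complex all_classical all_reals.
From mathcomp Require Import zify ring lra.

Set Implicit Arguments.
Unset Strict Implicit.
Unset Printing Implicit Defensive.

Import Order.TTheory GRing.Theory Num.Theory.
Import ComplexField.Normc.

Local Open Scope ring_scope.
Local Open Scope complex_scope.

(** * Power series, weight filtration and norms *)

(** The branch is never parametrized. Its semigroup is known only through dimensions of quotients,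
    so each use of it compares dimensions. The values of x and y are elements of the semigroup;
    conversely, a germ realizing n bounds the order of f from above, and a germ realizing m does the
    same for the exponent c of the pure power x^c. The latter is what rules out that the shifts of y
    overshoot m. Irreducibility concerns convergent series, so a formal factorization proves
    nothing. A weighted rescaling first makes the perturbation so small that the iteration stays in
    a ball of a submultiplicative norm, and the limit inherits the bound. Dimensions are bounded
    below by working modulo high weight, where everything is finite-dimensional and Steinitz
    exchange reduces the matter to counting monomials. As for the constant: each of the two
    corrections to (n - 1)(m - 1) is at most #H, hence less than an eighth of it. Less than a
    quarter is lost, so 4 tau > 3 (n - 1)(m - 1) >= 3 mu. *)

Section Fps2.
Variable K : comNzRingType.
Implicit Types a b : fps2 K.

Lemma fps2_coefD a b i j : (a + b) i j = a i j + b i j. Proof. by []. Qed.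
Lemma fps2_coefN a i j : (- a) i j = - a i j. Proof. by []. Qed.
Lemma fps2_coefB a b i j : (a - b) i j = a i j - b i j. Proof. by []. Qed.
Lemma fps2_coefZ c a i j : (c *: a) i j = c * a i j. Proof. by []. Qed.

Definition fps2_mon (k l : nat) : fps2 K :=
  fun i j => ((i == k) && (j == l))%:R.

Lemma fps2_mon_mulE k l a i j : (fps2_mon k l * a) i j =
  if (k <= i)%N && (l <= j)%N then a (i - k)%N (j - l)%N else 0.
Proof.
rewrite fps2_mulE; case: (leqP k i) => ki /=; last first.
  rewrite big1 // => s _; rewrite big1 // => t _; rewrite /fps2_mon.
  by rewrite ltn_eqF ?mul0r // (leq_ltn_trans _ ki) // -ltnS.
rewrite (bigD1 (Ordinal (ki : (k < i.+1)%N))) //= [X in _ + X]big1; last first.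
  move=> s; rewrite -val_eqE /= => /negbTE sk; rewrite big1 // => t _.
  by rewrite /fps2_mon sk mul0r.
rewrite addr0; case: (leqP l j) => lj; last first.
  rewrite big1 // => t _; rewrite /fps2_mon.
  by rewrite [(t : nat) == l]ltn_eqF ?andbF ?mul0r // (leq_ltn_trans _ lj) // -ltnS.
rewrite (bigD1 (Ordinal (lj : (l < j.+1)%N))) //= [X in _ + X]big1; last first.
  by move=> t; rewrite -val_eqE /fps2_mon /= => /negbTE ->; rewrite andbF mul0r.
by rewrite addr0 /fps2_mon !eqxx mul1r.
Qed.

Lemma fps2_mon_mul k l k' l' :
  fps2_mon k l * fps2_mon k' l' = fps2_mon (k + k') (l + l').
Proof.
apply: fps2P => i j; rewrite fps2_mon_mulE /fps2_mon.
case: andP => [[ki lj]|nkl].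
  by rewrite -(eqn_add2r k (i - k)) subnK // -(eqn_add2r l (j - l)) subnK //
             addnC (addnC l').
case: andP => // -[/eqP ei /eqP ej]; case: nkl.
by rewrite ei ej !leq_addr.
Qed.

Section Weight.
Variables p q : nat.

(** Weighted order at least [k]. This filtration is the metric of all fixed-point iterations, and
    with [p = q = 1] it is the usual order at the origin. *)
Definition vanish (k : nat) a : Prop :=
  forall i j, (p * i + q * j < k)%N -> a i j = 0.

Lemma vanish_le k l a : (l <= k)%N -> vanish k a -> vanish l a.
Proof. by move=> lk va i j ij; apply: va; exact: leq_trans lk. Qed.

Lemma vanishD k a b : vanish k a -> vanish k b -> vanish k (a + b).
Proof. by move=> va vb i j ij; rewrite fps2_coefD va ?vb ?addr0. Qed.

Lemma vanishN k a : vanish k a -> vanish k (- a).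
Proof. by move=> va i j ij; rewrite fps2_coefN va ?oppr0. Qed.

Lemma vanishB k a b : vanish k a -> vanish k b -> vanish k (a - b).
Proof. by move=> va vb; apply: vanishD => //; exact: vanishN. Qed.

Lemma vanishZ k c a : vanish k a -> vanish k (c *: a).
Proof. by move=> va i j ij; rewrite fps2_coefZ va ?mulr0. Qed.

Lemma vanish_sub0 k a b : vanish k (a - b) ->
  forall i j, (p * i + q * j < k)%N -> a i j = b i j.
Proof. by move=> v i j ij; apply/eqP; rewrite -subr_eq0 -fps2_coefB v. Qed.

Lemma vanishM k l a b : vanish k a -> vanish l b -> vanish (k + l) (a * b).
Proof.
move=> va vb i j ij; rewrite fps2_mulE big1 // => s _; rewrite big1 // => t _.
have [st|st] := ltnP (p * s + q * t) k; first by rewrite va ?mul0r.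
rewrite vb ?mulr0 //; rewrite -(ltn_add2l k); apply: leq_ltn_trans ij.
rewrite (leq_trans (leq_add st (leqnn _))) // addnACA -!mulnDr.
by rewrite !subnKC // -ltnS.
Qed.

Lemma vanish_mon i j : vanish (p * i + q * j) (fps2_mon i j).
Proof.
move=> s t; rewrite /fps2_mon; case: andP => // -[/eqP-> /eqP->].
by rewrite ltnn.
Qed.

Lemma vanish_all a : (0 < p)%N -> (0 < q)%N -> (forall k, vanish k a) -> a = 0.
Proof.
by move=> p0 q0 va; apply: fps2P => i j; apply: (va (p * i + q * j).+1).
Qed.

End Weight.
End Fps2.

(** * Norm estimates, limits and the geometric series *)

Section Bounds.
Variable R : realType.
Local Notation C := R[i].
Implicit Types a b : fps2 C.

Lemma bounded_term (r M : R) a i j : 0 <= r -> fps2_bounded r M a ->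
  normc (a i j) * r ^+ (i + j) <= M.
Proof.
move=> r0 /(_ (i + j).+1); apply: le_trans.
have iN : (i < (i + j).+1)%N by rewrite ltnS leq_addr.
have jN : (j < (i + j).+1)%N by rewrite ltnS leq_addl.
have t0 k l : 0 <= normc (a k l) * r ^+ (k + l).
  by rewrite mulr_ge0 ?normc_ge0 ?exprn_ge0.
rewrite (bigD1 (Ordinal iN)) //= (bigD1 (Ordinal jN)) //= -addrA lerDl.
by rewrite addr_ge0 ?sumr_ge0 // => k _; rewrite ?sumr_ge0.
Qed.

Lemma sum_half_le (N : nat) : \sum_(i < N) (2^-1 : R) ^+ i <= 2.
Proof.
suff -> : \sum_(i < N) (2^-1 : R) ^+ i = 2 - 2 * 2^-1 ^+ N.
  by rewrite gerBl mulr_ge0 ?exprn_ge0 ?invr_ge0.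
elim: N => [|N IH]; first by rewrite big_ord0 expr0 mulr1 subrr.
by rewrite big_ord_recr /= IH exprS; field.
Qed.

(** Cauchy estimates suit shifts of indices and substitutions, while the norm [fps2_bounded] suits
    products; this passes between the two. *)
Lemma convergent2_geomP a : a \in @convergent2 R <->
  exists C rho : R, 1 <= rho /\ forall i j, normc (a i j) <= C * rho ^+ (i + j).
Proof.
split=> [/convergent2P[r r0 [M H]]|[M [rho [rho1 H]]]].
  exists M, (Num.max 1 r^-1); split=> [|i j]; first by rewrite le_max lexx.
  have Mij := bounded_term i j (ltW r0) H.
  have M0 : 0 <= M.
    by apply: le_trans Mij; rewrite mulr_ge0 ?normc_ge0 ?exprn_ge0 ?(ltW r0).
  apply: le_trans (_ : M * r^-1 ^+ (i + j) <= _).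
    by rewrite exprVn ler_pdivlMr // exprn_gt0.
  rewrite ler_wpM2l // lerXn2r ?nnegrE ?invr_ge0 ?(ltW r0) //.
    by rewrite le_max invr_ge0 (ltW r0) orbT.
  by rewrite le_max lexx orbT.
have M0 : 0 <= M by have := H 0%N 0%N; rewrite expr0 mulr1; apply: le_trans (normc_ge0 _).
have rho0 : 0 < rho by apply: lt_le_trans rho1.
apply/convergent2P; exists (2 * rho)^-1; first by rewrite invr_gt0 mulr_gt0.
exists (M * (2 * 2)) => N.
apply: le_trans (_ : M * ((\sum_(i < N) 2^-1 ^+ i) * (\sum_(j < N) 2^-1 ^+ j)) <= _).
  rewrite mulr_suml mulr_sumr; apply: ler_sum => i _.
  rewrite mulr_sumr mulr_sumr; apply: ler_sum => j _.
  rewrite -exprD invfM exprMn mulrCA [leRHS]mulrC.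
  rewrite ler_wpM2l ?exprn_ge0 ?invr_ge0 // exprVn.
  by rewrite ler_pdivrMr ?exprn_gt0.
rewrite ler_wpM2l // ler_pM ?sumr_ge0 ?sum_half_le // => i _;
by rewrite exprn_ge0 ?invr_ge0.
Qed.

(** Meant for operations that move coefficients, such as division by a monomial: a shift by [k]
    degrees costs only the constant [rho ^+ k]. *)
Lemma convergent2_dom a b k :
  a \in @convergent2 R -> (forall i j, b i j = 0 \/ exists s t,
    (s + t <= i + j + k)%N /\ normc (b i j) <= normc (a s t)) ->
  b \in @convergent2 R.
Proof.
move=> /convergent2_geomP[M [rho [rho1 H]]] ab; apply/convergent2_geomP.
have M0 : 0 <= M by have := H 0%N 0%N; rewrite expr0 mulr1; apply: le_trans (normc_ge0 _).
exists (M * rho ^+ k), rho; split=> // i j.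
have [->|[s [t [st bst]]]] := ab i j.
  by rewrite normc0 !mulr_ge0 ?exprn_ge0 // (le_trans _ rho1).
apply: le_trans bst _; apply: le_trans (H _ _) _.
by rewrite -mulrA -exprD ler_wpM2l // ler_weXn2l // (addnC k).
Qed.

Lemma normc_real (x : R) : 0 <= x -> normc x%:C = x.
Proof. by move=> x0; rewrite /= expr0n addr0 sqrtr_sqr ger0_norm. Qed.

Lemma normc_natr (n : nat) : normc (n%:R : C) = n%:R.
Proof.
have : `|n%:R : C| = n%:R by rewrite normr_nat.
by rewrite -[in RHS](rmorph_nat (real_complex R)) => -[].
Qed.

Lemma normcX (z : C) n : normc (z ^+ n) = normc z ^+ n.
Proof.
by elim: n => [|n IH]; rewrite ?expr0 ?normc1 // !exprS normcM IH.
Qed.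

Lemma bounded_add (r M P : R) a b : 0 <= r ->
  fps2_bounded r M a -> fps2_bounded r P b -> fps2_bounded r (M + P) (a + b).
Proof.
move=> r0 HM HP N; apply: le_trans (lerD (HM N) (HP N)).
rewrite -big_split; apply: ler_sum => i _.
rewrite -big_split; apply: ler_sum => j _ /=.
by rewrite -mulrDl ler_wpM2r ?exprn_ge0 // normcD.
Qed.

Lemma normcN (z : C) : normc (- z) = normc z.
Proof. by case: z => u v; rewrite /= !sqrrN. Qed.

Lemma bounded_opp (r M : R) a : fps2_bounded r M a -> fps2_bounded r M (- a).
Proof.
move=> H N; apply: le_trans (H N); apply: ler_sum => i _; apply: ler_sum => j _.
by rewrite fps2_coefN normcN.
Qed.

Lemma bounded_1 (r : R) : fps2_bounded r 1 1.
Proof.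
move=> [|N]; first by rewrite big_ord0.
rewrite big_ord_recl [X in _ + X]big1 => [|k _]; last first.
  by rewrite big1 // => l _; rewrite normc0 mul0r.
rewrite addr0 big_ord_recl [X in _ + X]big1 => [|l _]; last first.
  by rewrite normc0 mul0r.
by rewrite addr0 normc1 mul1r addn0 expr0.
Qed.

(** The coefficient at (i, j) is frozen from step [(p * i + q * j).+1] on. Each finite box of the
    limit thus coincides with a box of a single iterate, which transfers the bound. *)
Lemma fps2_limit p q (r M : R) (z : nat -> fps2 C) : (0 < p)%N -> (0 < q)%N ->
  (forall N, vanish p q N (z N.+1 - z N)) ->
  (forall N, fps2_bounded r M (z N)) ->
  exists2 u, fps2_bounded r M u & forall N, vanish p q N (u - z N).
Proof.
move=> p0 q0 zS zM; pose u : fps2 C := fun i j => z (p * i + q * j).+1 i j.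
have stab N k i j : (p * i + q * j < N)%N -> z (N + k)%N i j = z N i j.
  move=> ij; elim: k => [|k <-]; first by rewrite addn0.
  rewrite addnS; apply: vanish_sub0 (zS _) _ _ _.
  by rewrite (leq_trans ij) ?leq_addr.
have uE N i j : (p * i + q * j < N)%N -> u i j = z N i j.
  by move=> ij; rewrite -(subnKC ij) stab.
exists u => [N|N i j ij]; last by rewrite fps2_coefB (uE N) ?subrr.
apply: le_trans (zM (p * N + q * N).+1 N).
apply: ler_sum => i _; apply: ler_sum => j _; rewrite (uE (p * N + q * N).+1) //.
by rewrite ltnS leq_add // leq_mul2l ltnW ?orbT.
Qed.

(** Without constant term every monomial has degree at least 1, so shrinking the radius by [t]
    shrinks the norm at least by [t]. The [M + 1] in [t] guards against [M = 0]. *)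
Lemma bounded_shrink (r M : R) a : 0 < r -> fps2_bounded r M a -> a 0%N 0%N = 0 ->
  exists2 s, 0 < s & fps2_bounded s (1 / 2) a.
Proof.
move=> r0 HM a0.
have M0 : 0 <= M by have := HM 0%N; rewrite big_ord0.
pose t : R := (2 * (M + 1))^-1.
have t0 : 0 < t by rewrite invr_gt0 mulr_gt0 // ltr_wpDl.
have t1 : t <= 1 by rewrite invf_le1 ?mulr_gt0 // ?ltr_wpDl //; lra.
exists (t * r); first by rewrite mulr_gt0.
move=> N; apply: le_trans (_ : t * M <= _); last first.
  by rewrite /t mulrC ler_pdivrMr ?mulr_gt0 // ?ltr_wpDl //; lra.
apply: le_trans (ler_wpM2l (ltW t0) (HM N)).
rewrite mulr_sumr; apply: ler_sum => i _; rewrite mulr_sumr; apply: ler_sum => j _.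
case: (posnP (i + j)) => [/eqP|ij].
  by rewrite addn_eq0 => /andP[/eqP-> /eqP->]; rewrite a0 normc0 !mul0r mulr0.
rewrite mulrCA ler_wpM2l ?normc_ge0 // exprMn ler_wpM2r ?exprn_ge0 ?(ltW r0) //.
by rewrite -(prednK ij) exprS ler_piMr ?exprn_ile1 ?(ltW t0).
Qed.

(** The inverse of [1 - a] as a fixed point: on a radius where [a] has norm at most 1/2, the map b
    -> 1 + a b preserves the ball of radius 2. *)
Lemma convergent2_geometric a : a \in @convergent2 R -> a 0%N 0%N = 0 ->
  exists2 b, b \in @convergent2 R & b = 1 + a * b.
Proof.
move=> /convergent2P[r r0 [M HM]] a0.
have [s s0 Hs] := bounded_shrink r0 HM a0.
pose z N : fps2 C := iter N (fun b => 1 + a * b) 0.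
have zE N : z N.+1 = 1 + a * z N by [].
have va : vanish 1 1 1 a by move=> [|i] [|j] //=; rewrite !mul1n.
have zS N : vanish 1 1 N (z N.+1 - z N).
  elim: N => [|N IH] //; rewrite zE {2}zE.
  rewrite opprD addrACA subrr add0r -mulrBr; exact: (vanishM va IH).
have zM N : fps2_bounded s 2 (z N).
  elim: N => [|N IH].
    move=> N; rewrite big1 // => i _; rewrite big1 // => j _.
    by rewrite -[z _ _ _]/(0 : C) normc0 mul0r.
  have -> : 2 = 1 + 1 / 2 * 2 :> R by field.
  by apply: bounded_add; [exact: ltW|exact: bounded_1|exact: fps2_bounded_mul].
have [b bM bz] := @fps2_limit 1 1 s 2 z erefl erefl zS zM.
exists b; first by apply/convergent2P; exists s => //; exists 2.
apply/eqP; rewrite -subr_eq0; apply/eqP; apply: (@vanish_all _ 1 1) => // k.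
have -> : b - (1 + a * b) = (b - z k.+1) - a * (b - z k).
  by rewrite zE; ring.
apply: vanishB; first exact: vanish_le (leqnSn k) (bz _).
by rewrite -(add0n k); apply: vanishM.
Qed.

End Bounds.

(** * Factorization of perturbed monomials *)

Section Rescaling.
Variables (K : comNzRingType) (p q : nat).
Implicit Types a b : fps2 K.

(** The substitution of [l ^+ p] x for x and [l ^+ q] y for y. *)
Definition fps2_rescale (l : K) a : fps2 K :=
  fun i j => a i j * l ^+ (p * i + q * j).

Lemma fps2_rescaleM l a b :
  fps2_rescale l (a * b) = fps2_rescale l a * fps2_rescale l b.
Proof.
apply: fps2P => i j; rewrite fps2_mulE /fps2_rescale fps2_mulE mulr_suml.
apply: eq_bigr => s _; rewrite mulr_suml; apply: eq_bigr => t _.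
have -> : (p * i + q * j = (p * s + q * t) + (p * (i - s) + q * (j - t)))%N.
  by rewrite addnACA -!mulnDr !subnKC // -ltnS.
by rewrite exprD mulrACA.
Qed.

End Rescaling.

Section Factorization.
Variable R : realType.
Local Notation C := R[i].
Implicit Types z : fps2 C.
Variables (p q i0 a : nat).
Hypotheses (p0 : (0 < p)%N) (q0 : (0 < q)%N).
Let W := (p * i0 + q * a)%N.

Definition ylow z : fps2 C := fun i j => if (j < a)%N then z (i + i0)%N j else 0.
Definition yhigh z : fps2 C := fun i j => z i (j + a)%N.

(** The only monomials lost by the splitting are x^i y^j with i < i0 and j < a, and these have
    weight below [W]. *)
Lemma ylow_yhigh z : vanish p q W z ->
  fps2_mon C 0 a * yhigh z + fps2_mon C i0 0 * ylow z = z.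
Proof.
move=> vz; apply: fps2P => i j; rewrite fps2_coefD !fps2_mon_mulE /= andbT subn0.
rewrite /yhigh /ylow subn0.
have [aj|ja] := leqP a j; first by rewrite subnK //; case: ifP; rewrite addr0.
rewrite add0r; case: leqP => [ii|ii]; first by rewrite subnK.
by rewrite vz // /W -addnS leq_add // ?leq_mul2l ?(ltnW ii) ?orbT // ltn_pmul2l.
Qed.

Lemma vanish_ylow k z : vanish p q (p * i0 + k) z -> vanish p q k (ylow z).
Proof.
move=> vz i j ij; rewrite /ylow; case: ifP => // _; apply: vz.
by rewrite mulnDr addnC addnA [X in (X < _)%N]addnC ltn_add2l addnC.
Qed.

Lemma vanish_yhigh k z : vanish p q (q * a + k) z -> vanish p q k (yhigh z).
Proof.
move=> vz i j ij; apply: vz.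
by rewrite mulnDr addnA [X in (X < _)%N]addnC ltn_add2l.
Qed.

(** The radius is 1 because there a shift of indices leaves the size of each term unchanged. *)
Lemma bounded_ylow M z : fps2_bounded 1 M z -> fps2_bounded 1 M (ylow z).
Proof.
move=> H N; apply: le_trans (H (i0 + N)%N).
rewrite big_split_ord /= -[leLHS]add0r lerD //.
  rewrite !sumr_ge0 // => i _; rewrite sumr_ge0 // => j _.
  by rewrite mulr_ge0 ?normc_ge0 ?exprn_ge0.
apply: ler_sum => i _; rewrite addnC big_split_ord /= -[leLHS]addr0 lerD //.
  apply: ler_sum => j _; rewrite !expr1n !mulr1 /ylow; case: ifP => _.
    by rewrite addnC.
  by rewrite normc0 normc_ge0.
by rewrite sumr_ge0 // => j _; rewrite mulr_ge0 ?normc_ge0 ?exprn_ge0.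
Qed.

Lemma bounded_yhigh M z : fps2_bounded 1 M z -> fps2_bounded 1 M (yhigh z).
Proof.
move=> H N; apply: le_trans (H (N + a)%N).
rewrite big_split_ord /= -[leLHS]addr0 lerD //; last first.
  rewrite !sumr_ge0 // => i _; rewrite sumr_ge0 // => j _.
  by rewrite mulr_ge0 ?normc_ge0 ?exprn_ge0.
apply: ler_sum => i _; rewrite addnC big_split_ord /= -[leLHS]add0r lerD //.
  by rewrite sumr_ge0 // => j _; rewrite mulr_ge0 ?normc_ge0 ?exprn_ge0.
by apply: ler_sum => j _; rewrite !expr1n !mulr1 /yhigh addnC.
Qed.

(* Writing [z = x^i0 g + y^a h] with [deg_y g < a], the factorization
   [(y^a + g) (x^i0 + h) = x^i0 y^a + psi] is the fixed-point equation
   [z = psi - g h], whose right-hand side is contracting for the weight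
   filtration and preserves the ball of radius 1/2. *)
Lemma factor_perturbed_monomial psi :
  fps2_bounded 1 (1 / 4) psi -> vanish p q W.+1 psi ->
  exists g h, [/\ fps2_bounded 1 (1 / 2) g, fps2_bounded 1 (1 / 2) h,
    vanish p q (q * a).+1 g, vanish p q (p * i0).+1 h &
    (fps2_mon C 0 a + g) * (fps2_mon C i0 0 + h) = fps2_mon C i0 a + psi].
Proof.
move=> bpsi vpsi.
pose Phi z := psi - ylow z * yhigh z.
pose z N : fps2 C := iter N Phi 0.
have zS N : z N.+1 = psi - ylow (z N) * yhigh (z N) by [].
have vlow u : vanish p q W.+1 u -> vanish p q (q * a).+1 (ylow u).
  by move=> vu; apply: vanish_ylow; rewrite addnS.
have vhigh u : vanish p q W.+1 u -> vanish p q (p * i0).+1 (yhigh u).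
  by move=> vu; apply: vanish_yhigh; rewrite addnS addnC.
have WE : ((q * a).+1 + (p * i0).+1 = W.+2)%N by rewrite addSn addnS addnC.
have vz N : vanish p q W.+1 (z N).
  elim: N => [|N IH] //; rewrite zS; apply: vanishB => //.
  apply: vanish_le (_ : W.+1 <= W.+2)%N _ => //; rewrite -WE.
  by apply: vanishM; [exact: vlow|exact: vhigh].
have bz N : fps2_bounded 1 (1 / 2) (z N).
  elim: N => [|N IH].
    move=> N; rewrite big1 ?divr_ge0 // => i _; rewrite big1 // => j _.
    by rewrite -[z _ _ _]/(0 : C) normc0 mul0r.
  have -> : 1 / 2 = 1 / 4 + 1 / 2 * (1 / 2) :> R by field.
  apply: bounded_add => //; apply: bounded_opp; apply: fps2_bounded_mul => //.
    exact: bounded_ylow.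
  exact: bounded_yhigh.
(* Contraction: in each summand of the Leibniz splitting, the factor without a difference vanishes
   one weight beyond y^a or x^i0, so agreement improves by one weight. *)
have diff k u v : vanish p q W.+1 u -> vanish p q W.+1 v ->
    vanish p q (W + k) (u - v) ->
    vanish p q (W + k.+1) (ylow u * yhigh u - ylow v * yhigh v).
  move=> vu vv vuv.
  have -> : ylow u * yhigh u - ylow v * yhigh v =
      (ylow u - ylow v) * yhigh u + ylow v * (yhigh u - yhigh v) by ring.
  apply: vanishD.
    have -> : (W + k.+1 = (q * a + k) + (p * i0).+1)%N by rewrite /W; lia.
    apply: vanishM; last exact: vhigh.
    have -> : ylow u - ylow v = ylow (u - v).
      apply: fps2P => i j; rewrite fps2_coefB /ylow fps2_coefB.
      by case: ifP; rewrite ?subrr.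
    by apply: vanish_ylow; rewrite addnA.
  have -> : (W + k.+1 = (q * a).+1 + (p * i0 + k))%N by rewrite /W; lia.
  apply: vanishM; first exact: vlow.
  have -> : yhigh u - yhigh v = yhigh (u - v) by [].
  by apply: vanish_yhigh; rewrite addnA (addnC (q * a)%N).
have zC N : vanish p q (W + N) (z N.+1 - z N).
  elim: N => [|N IH]; first by apply: vanishB; apply: vanish_le (vz _); rewrite addn0.
  rewrite zS {2}zS.
  have -> : psi - ylow (z N.+1) * yhigh (z N.+1) - (psi - ylow (z N) * yhigh (z N)) =
     - (ylow (z N.+1) * yhigh (z N.+1) - ylow (z N) * yhigh (z N)) by ring.
  by apply: vanishN; apply: diff.
have [u bu uz] : exists2 u, fps2_bounded 1 (1 / 2) u &
    forall N, vanish p q N (u - z N).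
  apply: (@fps2_limit _ p q 1 (1 / 2) z) => // N.
  exact: vanish_le (leq_addl _ _) (zC N).
have vu : vanish p q W.+1 u.
  by rewrite -[u](subrK (z W.+1)); apply: vanishD => //; exact: uz.
have uE : u = psi - ylow u * yhigh u.
  apply/eqP; rewrite -subr_eq0; apply/eqP; apply: (@vanish_all _ p q) => // k.
  have -> : u - (psi - ylow u * yhigh u) = (u - z (W + k).+1) +
     (ylow u * yhigh u - ylow (z (W + k)) * yhigh (z (W + k))%N).
    by rewrite zS; ring.
  apply: vanishD; first by apply: vanish_le (uz _); rewrite -addnS; lia.
  apply: vanish_le (diff k _ _ vu (vz _) (uz _)); lia.
exists (ylow u), (yhigh u); split; [exact: bounded_ylow|exact: bounded_yhigh|exact: vlow|exact: vhigh|].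
have E := ylow_yhigh (vanish_le (leqnSn _) vu).
have -> : psi = u + ylow u * yhigh u by rewrite {1}uE subrK.
rewrite -{3}E mulrDl !mulrDr fps2_mon_mul add0n addn0.
by ring.
Qed.

(** A coefficient of weight w > [W] is multiplied by [rho ^+ (w - W)], a positive power. In
    [rho = t * s], the factor [s] moves the radius from [r] to 1, using p i + q j >= i + j, and one
    factor [t] supplies the smallness. *)
Lemma bounded_rescale (r M : R) z : 0 < r -> fps2_bounded r M z -> vanish p q W.+1 z ->
  exists2 rho, 0 < rho & fps2_bounded 1 (1 / 4) ((rho%:C ^- W) *: fps2_rescale p q rho%:C z).
Proof.
move=> r0 HM vz.
pose s := Num.min 1 r.
have s0 : 0 < s by rewrite lt_min ltr01.
have s1 : s <= 1 by rewrite ge_min lexx.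
have sr : s <= r by rewrite ge_min lexx orbT.
have M0 : 0 <= M by have := HM 0%N; rewrite big_ord0.
pose B := s ^- W * M.
have B0 : 0 <= B by rewrite mulr_ge0 ?invr_ge0 ?exprn_ge0 ?(ltW s0).
pose t : R := (4 * (B + 1))^-1.
have t0 : 0 < t by rewrite invr_gt0 mulr_gt0 // ltr_wpDl.
have t1 : t <= 1 by rewrite invf_le1 ?mulr_gt0 // ?ltr_wpDl //; lra.
have ts0 : 0 < t * s by rewrite mulr_gt0.
exists (t * s) => // N.
apply: le_trans (_ : t * B <= _); last first.
  by rewrite /t mulrC ler_pdivrMr ?mulr_gt0 // ?ltr_wpDl //; lra.
rewrite /B mulrA.
have tW0 : 0 <= t / s ^+ W by rewrite divr_ge0 ?exprn_ge0 ?(ltW s0) ?(ltW t0).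
apply: le_trans (ler_wpM2l tW0 (HM N)).
rewrite mulr_sumr; apply: ler_sum => i _; rewrite mulr_sumr; apply: ler_sum => j _.
rewrite fps2_coefZ /fps2_rescale expr1n mulr1.
case: (ltnP (p * i + q * j) W.+1) => ij.
  by rewrite vz // mul0r mulr0 normc0 mul0r mulr0.
set w := (p * i + q * j)%N in ij *.
have -> : (t * s)%:C ^- W * (z i j * (t * s)%:C ^+ w) = z i j * (t * s)%:C ^+ (w - W).
  rewrite mulrCA -[in X in _ * (_ * X)](subnKC (ltnW ij)) exprD mulKf //.
  by rewrite expf_neq0 // fmorph_eq0 gt_eqF.
rewrite normcM normcX normc_real ?(ltW ts0) // mulrCA ler_wpM2l ?normc_ge0 // exprMn.
rewrite -mulrA ler_pM ?exprn_ge0 ?(ltW s0) ?(ltW t0) //.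
  have wW : (0 < w - W)%N by rewrite subn_gt0.
  by rewrite -(prednK wW) exprS ler_piMr ?exprn_ile1 ?(ltW t0).
rewrite ler_pdivlMl ?exprn_gt0 // -exprD subnKC ?(ltnW ij) //.
apply: le_trans (_ : s ^+ (i + j) <= _).
  by rewrite ler_wiXn2l ?(ltW s0) // /w leq_add // leq_pmull.
by rewrite lerXn2r ?nnegrE ?(ltW s0) ?(ltW r0).
Qed.

Lemma convergent2_rescale (l : R) z : 0 < l -> z \in @convergent2 R ->
  fps2_rescale p q l%:C z \in @convergent2 R.
Proof.
move=> l0 /convergent2_geomP[M [rho [rho1 H]]]; apply/convergent2_geomP.
pose L := Num.max 1 l.
have L1 : 1 <= L by rewrite le_max lexx.
have Ll : l <= L by rewrite le_max lexx orbT.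
have M0 : 0 <= M by have := H 0%N 0%N; rewrite expr0 mulr1; apply: le_trans (normc_ge0 _).
exists M, (rho * L ^+ (p + q)); split=> [|i j].
  by rewrite -[leLHS]mulr1 ler_pM ?exprn_ege1.
rewrite /fps2_rescale normcM normcX normc_real ?(ltW l0) // exprMn mulrA.
rewrite ler_pM ?normc_ge0 ?exprn_ge0 ?(ltW l0) // -exprM.
apply: le_trans (_ : L ^+ (p * i + q * j) <= _).
  by rewrite lerXn2r ?nnegrE ?(ltW l0) // (le_trans ler01).
by rewrite ler_weXn2l // mulnDl leq_add // leq_mul2l ?leq_addr ?leq_addl orbT.
Qed.

End Factorization.

(** * Germs and the vertices of their Newton polygons *)

Identity Coercion fps2_to_fun : fps2 >-> Funclass.

Section GermBasics.
Variable R : realType.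
Local Notation C := R[i].
Implicit Types a b f g h : germ2 R.

Lemma germ2_eqP a b : (forall i j, a i j = b i j) -> a = b.
Proof. by move=> ab; apply: val_inj; apply: fps2P. Qed.

Lemma germ2_coefD a b i j : (a + b) i j = a i j + b i j. Proof. by []. Qed.
Lemma germ2_coefB a b i j : (a - b) i j = a i j - b i j. Proof. by []. Qed.
Lemma germ2_coefZ c a i j : (c *: a) i j = c * a i j. Proof. by []. Qed.
Lemma germ2_fpsM a b : germ2_fps (a * b) = germ2_fps a * germ2_fps b.
Proof. by []. Qed.
Lemma germ2_coef1 i j : (1 : germ2 R) i j = ((i == 0%N) && (j == 0%N))%:R.
Proof. by []. Qed.

Lemma germ2_coef_sum I (s : seq I) (P : pred I) (F : I -> germ2 R) i j :
  (\sum_(k <- s | P k) F k) i j = \sum_(k <- s | P k) F k i j.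
Proof. by elim/big_rec2: _ => // k u v _ <-. Qed.

Fact convergent2_mon k l : fps2_mon C k l \in @convergent2 R.
Proof.
apply/convergent2_geomP; exists 1, 1; split=> // i j.
by rewrite expr1n mulr1 /fps2_mon; case: (_ && _); rewrite ?normc0 ?normc1.
Qed.
Definition gmon k l : germ2 R := Germ2 (convergent2_mon k l).

Lemma gmonE k l i j : gmon k l i j = ((i == k) && (j == l))%:R.
Proof. by []. Qed.

Lemma gmon_mulE k l a i j : (gmon k l * a) i j =
  if (k <= i)%N && (l <= j)%N then a (i - k)%N (j - l)%N else 0.
Proof. exact: fps2_mon_mulE. Qed.

Lemma gmonM k l k' l' : gmon k l * gmon k' l' = gmon (k + k') (l + l').
Proof. by apply: val_inj; exact: fps2_mon_mul. Qed.

Lemma gmon00 : gmon 0 0 = 1. Proof. exact: val_inj. Qed.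

Lemma at0M a b : at0 (a * b) = at0 a * at0 b.
Proof. by rewrite /at0 germ2_fpsM fps2_mulE !big_ord1. Qed.

Lemma germ2_unitE f : (f \is a GRing.unit) = (at0 f != 0).
Proof.
apply/idP/idP => [uf|f0].
  apply/eqP => f0; have := congr1 (@at0 R) (mulrV uf).
  by rewrite at0M f0 mul0r => /esym/eqP; rewrite oner_eq0.
set c := at0 f in f0 *.
have a0 : at0 (1 - c^-1 *: f) = 0.
  by rewrite /at0 germ2_coefB germ2_coefZ germ2_coef1 mulVf // subrr.
have [b cb bE] := convergent2_geometric (germ2P (1 - c^-1 *: f)) a0.
have [B {}bE] : exists B, B = 1 + (1 - c^-1 *: f) * B.
  by exists (Germ2 cb); apply: val_inj.
have E : (c^-1 *: f) * B = 1.
  have -> : (c^-1 *: f) * B = B - (1 - c^-1 *: f) * B by ring.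
  by rewrite {1}bE addrK.
apply/unitrPr; exists (c^-1 *: B).
by rewrite -scalerAr scalerAl.
Qed.

Section Vanish.
Variables p q : nat.
Local Notation van k a := (vanish p q k (germ2_fps a)).

Lemma gvanishD k a b : van k a -> van k b -> van k (a + b).
Proof. exact: vanishD. Qed.
Lemma gvanishB k a b : van k a -> van k b -> van k (a - b).
Proof. exact: vanishB. Qed.
Lemma gvanishZ k c a : van k a -> van k (c *: a).
Proof. exact: vanishZ. Qed.
Lemma gvanishM k l a b : van k a -> van l b -> van (k + l)%N (a * b).
Proof. exact: vanishM. Qed.
Lemma gvanishMl k a b : van k b -> van k (a * b).
Proof. by move=> vb; rewrite -(add0n k); apply: gvanishM. Qed.
Lemma gvanishMr k a b : van k a -> van k (a * b).
Proof. by move=> va; rewrite -(addn0 k); apply: gvanishM. Qed.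
Lemma gvanish0 k : van k (0 : germ2 R). Proof. by []. Qed.
Lemma gvanish_mon i j : van (p * i + q * j)%N (gmon i j).
Proof. exact: vanish_mon. Qed.
End Vanish.

(** Such an [f] is a perturbed monomial. After normalization and rescaling it factors, and undoing
    the rescaling with [rho^-1] gives two factors vanishing at the origin, since [a] and [i0] are
    positive. *)
Lemma irreducible_vertex f (p q i0 a : nat) :
  (0 < p)%N -> (0 < q)%N -> (0 < i0)%N -> (0 < a)%N -> f i0 a != 0 ->
  (forall i j, f i j != 0 -> (i, j) != (i0, a) ->
     (p * i0 + q * a < p * i + q * j)%N) ->
  ~ irreducible_elt f.
Proof.
move=> p0 q0 i00 a0 c0 fW [_ _ irr].
set c := f i0 a in c0; set W := (p * i0 + q * a)%N in fW.
pose psi := c^-1 *: f - gmon i0 a.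
have psiE i j : psi i j = c^-1 * f i j - ((i == i0) && (j == a))%:R by [].
have vpsi : vanish p q W.+1 psi.
  move=> i j ij; rewrite psiE.
  have [/andP[/eqP-> /eqP->]|ne] := boolP (_ && _); first by rewrite mulVf ?subrr.
  rewrite subr0; have [->|fij] := eqVneq (f i j) 0; first by rewrite mulr0.
  have := fW i j fij; rewrite xpair_eqE ne => /(_ isT).
  by move=> lt; move: ij; rewrite ltnS leqNgt lt.
have [r r0 [M HM]] : exists2 r : R, 0 < r & exists M, fps2_bounded r M psi.
  by apply/convergent2P; exact: germ2P.
have [rho rho0 Hrho] := bounded_rescale p0 q0 r0 HM vpsi.
set l := rho%:C in Hrho.
have l0 : l != 0 by rewrite fmorph_eq0 gt_eqF.
have vres : vanish p q W.+1 (l ^- W *: fps2_rescale p q l psi).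
  by apply: vanishZ => i j ij; rewrite /fps2_rescale vpsi ?mul0r.
have [g [h [bg bh vg vh E]]] := factor_perturbed_monomial p0 q0 Hrho vres.
have conv z : fps2_bounded 1 (1 / 2) z -> z \in @convergent2 R.
  by move=> bz; apply/convergent2P; exists 1 => //; exists (1 / 2).
have cG : fps2_mon C 0 a + g \in @convergent2 R.
  by rewrite rpredD ?convergent2_mon ?conv.
have cH : fps2_mon C i0 0 + h \in @convergent2 R.
  by rewrite rpredD ?convergent2_mon ?conv.
have li0 : 0 < rho^-1 by rewrite invr_gt0.
pose G := (c * l ^+ W) *: Germ2 (convergent2_rescale p q li0 cG).
pose H := Germ2 (convergent2_rescale p q li0 cH).
have fE : f = G * H.
  apply: germ2_eqP => i j; rewrite -scalerAl germ2_coefZ germ2_fpsM /=.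
  rewrite -fps2_rescaleM E /fps2_rescale fps2_coefD fps2_coefZ.
  rewrite psiE /fps2_mon.
  rewrite fmorphV exprVn -/l.
  have lw : l ^+ (p * i + q * j) != 0 by rewrite expf_neq0.
  have lW : l ^+ W != 0 by rewrite expf_neq0.
  have [/andP[/eqP ei /eqP ej]|ne] := boolP (_ && _).
    rewrite ei ej -/W -/c mulVf // subrr.
    by rewrite mul0r mulr0 addr0 mul1r mulfK.
  rewrite subr0 add0r; set x := f i j; clear -c0 lw lW.
  by rewrite -(mulrA (l ^- W)) mulfK // -(mulrA c) mulVKf // mulVKf.
have G0 : at0 G = 0.
  rewrite /at0 germ2_coefZ /= /fps2_rescale fps2_coefD vg ?muln0 //.
  by rewrite /fps2_mon eq_sym (gtn_eqF a0) addr0 !mul0r mulr0.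
have H0 : at0 H = 0.
  rewrite /at0 /= /fps2_rescale fps2_coefD vh ?muln0 //.
  by rewrite /fps2_mon (ltn_eqF i00) addr0 !mul0r.
by have [] := irr _ _ fE; rewrite germ2_unitE ?G0 ?H0 eqxx.
Qed.

(* Tilting the weights slightly makes the lowest monomial of the face the
   unique one of minimal weight. *)
Lemma irreducible_face f (p q i0 a : nat) :
  irreducible_elt f -> (0 < p)%N -> (0 < q)%N -> f i0 a != 0 ->
  (forall i j, f i j != 0 -> (p * i0 + q * a <= p * i + q * j)%N) ->
  (forall i j, f i j != 0 -> (p * i0 + q * a = p * i + q * j)%N -> (a <= j)%N) ->
  i0 = 0%N \/ a = 0%N.
Proof.
move=> irr p0 q0 c0 fW fa.
case: (posnP i0) => [->|i00]; first by left.
case: (posnP a) => [->|a0]; first by right.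
exfalso; move: irr.
(* The tilted weight is [a.+1] times the old one plus the exponent of y. As [a < a.+1], a gap of one
   in the old weight outweighs the tilt. *)
apply: (@irreducible_vertex f (a.+1 * p) (a.+1 * q + 1) i0 a) => //.
- by rewrite muln_gt0.
- by rewrite addn1.
move=> i j fij ne; have le := fW i j fij; have ea := fa i j fij.
have tilt s t : (a.+1 * p * s + (a.+1 * q + 1) * t = a.+1 * (p * s + q * t) + t)%N.
  by ring.
rewrite !tilt.
have [e|ne'] := eqVneq (p * i0 + q * a)%N (p * i + q * j)%N.
  rewrite e ltn_add2l ltn_neqAle ea // andbT.
  apply: contra ne => /eqP aj; rewrite -aj in e *; move/addIn/eqP: e.
  by rewrite eqn_pmul2l // xpair_eqE eqxx andbT eq_sym.
have lt : (p * i0 + q * a < p * i + q * j)%N by rewrite ltn_neqAle ne' le.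
move: lt; set u := (p * i0 + q * a)%N; set v := (p * i + q * j)%N => uv.
apply: leq_trans (leq_addr _ _); apply: (@leq_trans (a.+1 * u.+1)).
  by rewrite mulnS addnC ltn_add2r.
by rewrite leq_mul2l uv orbT.
Qed.

End GermBasics.

(** * Codimensions of ideals *)

Section LinearAlgebra.
Variables (K : fieldType) (A : lmodType K).
Implicit Types (W : A -> Prop) (s t : seq A) (g : A).

Definition lin_closed W : Prop :=
  W 0 /\ forall c u v, W u -> W v -> W (c *: u + v).

Lemma lin_closedD W u v : lin_closed W -> W u -> W v -> W (u + v).
Proof. by move=> [_ H] Wu Wv; rewrite -[u]scale1r; apply: H. Qed.

Lemma lin_closedZ W c u : lin_closed W -> W u -> W (c *: u).
Proof. by move=> [W0 H] Wu; rewrite -[c *: u]addr0; apply: H. Qed.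

Lemma lin_closedN W u : lin_closed W -> W u -> W (- u).
Proof. by move=> H Wu; rewrite -scaleN1r; apply: lin_closedZ. Qed.

Lemma lin_closedB W u v : lin_closed W -> W u -> W v -> W (u - v).
Proof. by move=> H Wu Wv; apply: lin_closedD => //; apply: lin_closedN. Qed.

Lemma lin_closed_sum W I (r : seq I) (P : pred I) (F : I -> A) :
  lin_closed W -> (forall i, P i -> W (F i)) -> W (\sum_(i <- r | P i) F i).
Proof.
move=> HW WF; elim/big_ind: _ => //; first by case: HW.
by move=> u v; apply: lin_closedD.
Qed.

(** The span of [s] modulo [W], expressed without forming a quotient space. *)
Definition inspan W s g : Prop :=
  exists c : nat -> K, W (g - \sum_(i < size s) c i *: s`_i).

Lemma inspan_lin W s : lin_closed W -> lin_closed (inspan W s).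
Proof.
move=> HW; split=> [|c u v [cu Hu] [cv Hv]].
  exists (fun=> 0); rewrite big1 ?subr0 => [|i _]; first by case: HW.
  by rewrite scale0r.
exists (fun i => c * cu i + cv i).
have -> : \sum_(i < size s) (c * cu i + cv i) *: s`_i =
   c *: (\sum_(i < size s) cu i *: s`_i) + \sum_(i < size s) cv i *: s`_i.
  rewrite scaler_sumr -big_split; apply: eq_bigr => i _ /=.
  by rewrite scalerDl scalerA.
rewrite opprD addrACA -scalerBr.
by apply: lin_closedD => //; apply: lin_closedZ.
Qed.

Lemma inspan_mod W s g : lin_closed W -> W g -> inspan W s g.
Proof.
move=> HW Wg; exists (fun=> 0); rewrite big1 ?subr0 // => i _.
by rewrite scale0r.
Qed.

Lemma inspan_mem W s g : lin_closed W -> g \in s -> inspan W s g.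
Proof.
move=> [W0 _] gs; exists (fun i => (i == index g s)%:R).
have gi : (index g s < size s)%N by rewrite index_mem.
rewrite (bigD1 (Ordinal gi)) //= eqxx scale1r nth_index // big1 ?addr0 ?subrr //.
by move=> i; rewrite -val_eqE /= => /negbTE ->; rewrite scale0r.
Qed.

Lemma inspan_trans W s t g : lin_closed W ->
  (forall x, x \in s -> inspan W t x) -> inspan W s g -> inspan W t g.
Proof.
move=> HW st [c Hc]; have Ht := inspan_lin t HW.
rewrite -[g](subrK (\sum_(i < size s) c i *: s`_i)); apply: lin_closedD => //.
  exact: inspan_mod.
by apply: lin_closed_sum => // i _; apply: lin_closedZ => //; apply/st/mem_nth.
Qed.

(** A coefficient matrix with more rows than columns has a nonzero vector in its left kernel, which
    would be a relation between the [b i] modulo [W]. *)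
Lemma steinitz W d (b : 'I_d -> A) s : lin_closed W ->
  (forall c : 'I_d -> K, W (\sum_i c i *: b i) -> forall i, c i = 0) ->
  (forall i, inspan W s (b i)) -> (d <= size s)%N.
Proof.
move=> HW indep bs; rewrite leqNgt; apply/negP => lt.
have [M HM] := choice bs.
pose N : 'M[K]_(d, size s) := \matrix_(i, j) M i j.
have : kermx N != 0.
  by rewrite kermx_eq0 /row_free neq_ltn (leq_ltn_trans (rank_leq_col _) lt).
move=> /rowV0Pn[u uk u0].
have uN : u *m N = 0 by apply/sub_kermxP.
suff z i : u 0 i = 0 by case/eqP: u0; apply/rowP => i; rewrite z mxE.
move: i; apply: indep.
have -> : \sum_i u 0 i *: b i =
    \sum_i u 0 i *: (b i - \sum_(j < size s) M i j *: s`_j).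
  rewrite -[LHS]subr0 -[X in _ - X](_ : \sum_i u 0 i *: \sum_(j < size s) M i j *: s`_j = 0).
    by rewrite -sumrB; apply: eq_bigr => i _; rewrite scalerBr.
  under eq_bigr do rewrite scaler_sumr.
  rewrite exchange_big big1 // => j _ /=.
  under eq_bigr do rewrite scalerA.
  rewrite -scaler_suml.
  have := congr1 (fun v : 'rV_(size s) => v 0 j) uN; rewrite !mxE => uNj.
  by rewrite [X in X *: _](_ : _ = 0) ?scale0r // -[RHS]uNj; apply: eq_bigr => i _; rewrite /N mxE.
by apply: lin_closed_sum => // i _; apply: lin_closedZ.
Qed.

Lemma quot_dimP (I : set A) d : lin_closed I -> quot_dim I d <->
  exists b : 'I_d -> A,
    (forall c : 'I_d -> K, I (\sum_i c i *: b i) -> forall i, c i = 0) /\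
    (forall g, exists c : 'I_d -> K, I (g - \sum_i c i *: b i)).
Proof.
move=> HI; split=> -[b].
  move=> H; exists b; split=> [c Ic i|g]; last by have [c [? _]] := H g; exists c.
  have [c0 [_ u]] := H 0.
  have u0 : c0 = [ffun=> 0].
    apply: u; rewrite big1 ?subr0; first by case: HI.
    by move=> j _; rewrite ffunE scale0r.
  have : c0 = [ffun j => - c j].
    apply: u; rewrite sub0r -sumrN.
    under eq_bigr do rewrite ffunE scaleNr opprK.
    exact: Ic.
  by rewrite u0 => /ffunP/(_ i); rewrite !ffunE => /esym/eqP; rewrite oppr_eq0 => /eqP.
move=> [indep gen]; exists b => g; have [c Hc] := gen g.
have E (c' : 'I_d -> K) : \sum_i [ffun i => c' i] i *: b i = \sum_i c' i *: b i.
  by apply: eq_bigr => i _; rewrite ffunE.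
exists [ffun i => c i]; split=> [|c' Hc']; first by rewrite E.
apply/ffunP => i; rewrite ffunE; apply/eqP; rewrite -subr_eq0; apply/eqP.
move: i; apply: (indep (fun i => c i - c' i)).
under eq_bigr do rewrite scalerBl.
rewrite sumrB.
have -> : \sum_i c i *: b i - \sum_i c' i *: b i =
   (g - \sum_i c' i *: b i) - (g - \sum_i c i *: b i).
  by rewrite opprB [RHS]addrC addrA subrK.
exact: lin_closedB.
Qed.

Lemma quot_dim_le_size (I : set A) d s : lin_closed I -> quot_dim I d ->
  (forall g, inspan I s g) -> (d <= size s)%N.
Proof.
by move=> HI /(quot_dimP _ HI)[b [indep _]] Is; apply: (@steinitz I d b).
Qed.

(** A basis of [A / I] followed by [s] spans [A] modulo [W], so the exchange lemma applies. The
    lower bounds on codimensions below come from here, with [W] a step of the weight filtration. *)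
Lemma quot_dim_ge (W I : set A) d d' (b : 'I_d' -> A) s :
  lin_closed W -> lin_closed I -> quot_dim I d ->
  (forall c : 'I_d' -> K, W (\sum_i c i *: b i) -> forall i, c i = 0) ->
  (forall g, I g -> inspan W s g) -> (d' <= d + size s)%N.
Proof.
move=> HW HI /(quot_dimP _ HI)[e [_ gen]] indep Is.
have -> : (d + size s = size (codom e ++ s))%N by rewrite size_cat size_codom card_ord.
apply: (steinitz HW indep) => i; have Hl := inspan_lin (codom e ++ s) HW.
have [c Hc] := gen (b i).
rewrite -[b i](subrK (\sum_i c i *: e i)); apply: lin_closedD => //.
  apply: inspan_trans (Is _ Hc) => // x xs; apply: inspan_mem => //.
  by rewrite mem_cat xs orbT.
apply: lin_closed_sum => // j _; apply: lin_closedZ => //; apply: inspan_mem => //.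
by rewrite mem_cat codom_f.
Qed.

End LinearAlgebra.

Section Ideals.
Variable A : comNzRingType.
Implicit Types (s : seq A) (a b g : A).

Lemma gen_ideal2P a b g :
  gen_ideal [:: a; b] g <-> exists u v, g = u * a + v * b.
Proof.
split=> [[c ->]|[u [v ->]]].
  by exists (c 0%N), (c 1%N); rewrite !big_ord_recl big_ord0 addr0.
by exists (fun i => if i is 0 then u else v); rewrite !big_ord_recl big_ord0 addr0.
Qed.

Lemma gen_ideal3P a b b' g :
  gen_ideal [:: a; b; b'] g <-> exists u v w, g = u * a + v * b + w * b'.
Proof.
split=> [[c ->]|[u [v [w ->]]]].
  exists (c 0%N), (c 1%N), (c 2%N).
  by rewrite !big_ord_recl big_ord0 addr0 addrA.
exists (fun i => if i is i.+1 then if i is 0 then v else w else u).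
by rewrite !big_ord_recl big_ord0 addr0 addrA.
Qed.

Lemma gen_idealMl s a g : gen_ideal s g -> gen_ideal s (a * g).
Proof.
move=> [c ->]; exists (fun i => a * c i); rewrite mulr_sumr.
by apply: eq_bigr => i _; rewrite mulrA.
Qed.

Lemma gen_idealD s a b : gen_ideal s a -> gen_ideal s b -> gen_ideal s (a + b).
Proof.
move=> [c ->] [c' ->]; exists (fun i => c i + c' i); rewrite -big_split.
by apply: eq_bigr => i _; rewrite mulrDl.
Qed.

Lemma gen_ideal0 s : gen_ideal s 0.
Proof. by exists (fun=> 0); rewrite big1 // => i _; rewrite mul0r. Qed.

Lemma gen_ideal_mem s a : a \in s -> gen_ideal s a.
Proof.
move=> a_s; exists (fun i => (i == index a s)%:R).
have gi : (index a s < size s)%N by rewrite index_mem.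
rewrite (bigD1 (Ordinal gi)) //= eqxx mul1r nth_index // big1 ?addr0 //.
by move=> i; rewrite -val_eqE /= => /negbTE ->; rewrite mul0r.
Qed.

End Ideals.

(** * Ideals of finite codimension in the ring of germs *)

Section GermIdeals.
Variable R : realType.
Implicit Types (f g h : germ2 R) (s : seq (germ2 R)).

Lemma gen_ideal_lin s : lin_closed (gen_ideal s : germ2 R -> Prop).
Proof.
split=> [|c u v Hu Hv]; first exact: gen_ideal0.
by apply: gen_idealD => //; rewrite -mulr_algl; apply: gen_idealMl.
Qed.

Lemma vanish_lin p q k : lin_closed (fun g : germ2 R => vanish p q k g).
Proof.
split=> [|c u v Hu Hv]; first exact: gvanish0.
by apply: gvanishD => //; apply: gvanishZ.
Qed.

(** The d + 1 powers 1, ..., [x ^+ d] are dependent modulo the ideal, and a relation between them is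
    its lowest power of [x] times a unit. *)
Lemma fin_codim_power s d x : quot_dim (gen_ideal s) d -> at0 x = 0 ->
  gen_ideal s (x ^+ d).
Proof.
move=> Hd x0; have HI := gen_ideal_lin s.
have [b [_ gen]] := (quot_dimP _ HI).1 Hd.
suff [c [Ic [i ci]]] : exists c : 'I_d.+1 -> R[i],
    gen_ideal s (\sum_i c i *: x ^+ i) /\ exists i, c i != 0.
  have [k ck kmin] := @arg_minnP _ i (fun i => c i != 0) val ci.
  pose u := \sum_(j < d.+1 | (k <= j)%N) c j *: x ^+ (j - k).
  have uE : \sum_j c j *: x ^+ j = x ^+ k * u.
    rewrite mulr_sumr (bigID (fun j : 'I__ => (k <= j)%N)) /= [X in _ + X]big1 ?addr0.
      by apply: eq_bigr => j kj; rewrite -scalerAr -exprD subnKC.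
    move=> j; rewrite -ltnNge => jk; case: (eqVneq (c j) 0) => [->|cj].
      by rewrite scale0r.
    by have := kmin j cj; rewrite leqNgt jk.
  have uu : u \is a GRing.unit.
    rewrite germ2_unitE /u /at0 germ2_coef_sum (bigD1 k) //= big1 => [|j].
      by rewrite addr0 fps2_coefZ subnn expr0 germ2_coef1 mulr1.
    move=> /andP[kj jk].
    have jk0 : (0 < j - k)%N by rewrite subn_gt0 ltn_neqAle eq_sym (inj_eq val_inj) jk.
    by rewrite fps2_coefZ -(prednK jk0) exprS -/(at0 _) at0M x0 mul0r mulr0.
  have -> : x ^+ d = x ^+ (d - k) * u^-1 * (x ^+ k * u).
    rewrite mulrACA mulVr // mulr1 -exprD subnK // -ltnS; exact: ltn_ord.
  by apply: gen_idealMl; rewrite -uE.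
apply: contrapT => H.
suff : (d.+1 <= size (codom b))%N by rewrite size_codom card_ord ltnn.
apply: (@steinitz _ _ (gen_ideal s) _ (fun i : 'I_d.+1 => x ^+ i)) => //.
  move=> c Ic i; apply/eqP; apply: contrapT => ci; apply: H; exists c; split=> //.
  by exists i; apply/negP.
move=> i; have [c Hc] := gen (x ^+ i); have Hl := inspan_lin (codom b) HI.
rewrite -[_ ^+ _](subrK (\sum_i c i *: b i)); apply: lin_closedD => //.
  exact: inspan_mod.
apply: lin_closed_sum => // j _; apply: lin_closedZ => //.
by apply: inspan_mem => //; apply: codom_f.
Qed.

Lemma gmonX k l d : gmon R k l ^+ d = gmon R (k * d) (l * d).
Proof.
elim: d => [|d IH]; first by rewrite !muln0 gmon00.
by rewrite exprS IH gmonM !mulnS.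
Qed.

Fact convergent2_xshift d (g : germ2 R) :
  (fun i j => g (i + d)%N j : R[i]) \in @convergent2 R.
Proof.
apply: (@convergent2_dom _ g _ d (germ2P g)) => i j; right.
by exists (i + d)%N, j; split=> //; rewrite addnAC.
Qed.

Fact convergent2_yshift d e (g : germ2 R) :
  (fun i j => if (i < d)%N then g i (j + e)%N else 0 : R[i]) \in @convergent2 R.
Proof.
apply: (@convergent2_dom _ g _ e (germ2P g)) => i j; case: ifP => _; last by left.
by right; exists i, (j + e)%N; split=> //; rewrite addnA.
Qed.

Lemma split_box d e g : (forall i j, (i < d)%N -> (j < e)%N -> g i j = 0) ->
  g = gmon R d 0 * Germ2 (convergent2_xshift d g) +
      gmon R 0 e * Germ2 (convergent2_yshift d e g).
Proof.
move=> g0; apply: germ2_eqP => i j; rewrite germ2_coefD !gmon_mulE /= andbT !subn0.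
case: leqP => [di|id] /=; first by rewrite subnK // if_same addr0.
by rewrite add0r; case: leqP => ej; [rewrite subnK|rewrite g0].
Qed.

(** A monomial of weight at least p d + q d is divisible by x^d or y^d, both of which lie in the
    ideal. Eliminations modulo the ideal therefore stop at a finite weight. *)
Lemma fin_codim_vanish s d p q : (0 < p)%N -> (0 < q)%N ->
  quot_dim (gen_ideal s) d ->
  exists K, forall g, vanish p q K g -> gen_ideal s g.
Proof.
move=> p0 q0 Hd; exists (p * d + q * d)%N => g vg.
rewrite (@split_box d d g) => [|i j id jd]; last first.
  apply: vg; apply: (@leq_ltn_trans (p * i + q * d)); last by rewrite ltn_add2r ltn_pmul2l.
  by rewrite leq_add2l leq_mul2l (ltnW jd) orbT.
apply: gen_idealD; rewrite mulrC; apply: gen_idealMl.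
  have := @fin_codim_power s d (gmon R 1 0) Hd.
  by rewrite gmonX mul1n mul0n; apply.
have := @fin_codim_power s d (gmon R 0 1) Hd.
by rewrite gmonX mul1n mul0n; apply.
Qed.

End GermIdeals.

(** * The substitutions y -> y + al x^k *)

Section Filling.
Variable R : realType.
Local Notation C := R[i].

(** Gaussian elimination, one weight at a time: the part of [g] of weight [k] is cancelled by
    elements of [Z] whose initial forms are single monomials, and what remains has larger weight. *)
Lemma vanish_fill p q K k (Z : germ2 R -> Prop) : (0 < p)%N -> (0 < q)%N ->
  lin_closed Z -> (forall g : germ2 R, vanish p q K g -> Z g) ->
  (forall i j, (k <= p * i + q * j < K)%N -> exists e c,
     [/\ Z e, c != 0 & vanish p q (p * i + q * j).+1 (e - c *: gmon R i j)]) ->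
  forall g : germ2 R, vanish p q k g -> Z g.
Proof.
move=> p0 q0 HZ ZK; move: {2}(K - k)%N (leqnn (K - k)) => n.
elim: n k => [|n IH] k kn lead g vg.
  by apply: ZK; apply: vanish_le vg; rewrite -subn_eq0 -leqn0.
have [Kk|kK] := leqP K k; first by apply: ZK; apply: vanish_le vg.
(* Positive weights bound the exponents of a monomial of weight [k] by [k], so this finite box
   contains them all. *)
pose w (u : 'I_k.+1 * 'I_k.+1) := (p * u.1 + q * u.2)%N.
have /choice[E HE] : forall u, exists e : germ2 R * C, w u = k ->
    [/\ Z e.1, e.2 != 0 & vanish p q k.+1 (e.1 - e.2 *: gmon R u.1 u.2)].
  move=> u; have [wu|wu] := eqVneq (w u) k; last by exists (0, 0) => /eqP; rewrite (negPf wu).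
  have [|e [c [Ze c0 ve]]] := lead u.1 u.2.
    by rewrite -[(p * u.1 + _)%N]/(w u) wu leqnn kK.
  exists (e, c) => _; split=> //=.
  by move: ve; rewrite -[(p * u.1 + _)%N]/(w u) wu.
pose S := \sum_(u | w u == k) (g u.1 u.2 / (E u).2) *: (E u).1.
have ZS : Z S.
  by apply: lin_closed_sum => // u /eqP /HE[ZE _ _]; apply: lin_closedZ.
rewrite -[g](subrK S); apply: lin_closedD => //.
apply: (IH k.+1); first by rewrite subnS -ltnS prednK ?subn_gt0 // (leq_trans _ kn).
  by move=> i j /andP[ki iK]; apply: lead; rewrite (ltnW ki).
move=> I J IJ; rewrite germ2_coefB /S germ2_coef_sum.
have Ec u : w u == k -> ((g u.1 u.2 / (E u).2) *: (E u).1 : germ2 R) I J =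
    if (I == u.1 :> nat) && (J == u.2 :> nat) then g I J else 0.
  move=> /eqP /HE[_ c0 ve]; rewrite germ2_coefZ.
  have -> : (E u).1 I J = (E u).2 * ((I == u.1) && (J == u.2))%:R.
    by apply/eqP; rewrite -subr_eq0 -gmonE -germ2_coefZ -germ2_coefB ve.
  by case: ifP => [/andP[/eqP-> /eqP->]|_]; rewrite ?mulr0 // mulr1 divfK.
rewrite (eq_bigr _ Ec) -big_mkcondr /=.
have [wIJ|wIJ] := eqVneq (p * I + q * J)%N k; last first.
  rewrite vg; last by rewrite ltn_neqAle wIJ -ltnS.
  by rewrite big1 ?subr0.
have Ik : (I < k.+1)%N by rewrite ltnS -wIJ (leq_trans (leq_pmull I p0)) ?leq_addr.
have Jk : (J < k.+1)%N by rewrite ltnS -wIJ (leq_trans (leq_pmull J q0)) ?leq_addl.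
rewrite (bigD1 (Ordinal Ik, Ordinal Jk)) /= ?big1 ?addr0 ?subrr //; last first.
  by rewrite /w /= wIJ !eqxx.
case=> u1 u2 /= /andP[/andP[_ /andP[/eqP eI /eqP eJ]]].
by rewrite xpair_eqE -!val_eqE /= eI eJ !eqxx.
Qed.

(** The induction principle for linear statements about germs: monomials span modulo each step of
    the filtration. *)
Lemma vanish_dense p q K (Z : germ2 R -> Prop) : (0 < p)%N -> (0 < q)%N ->
  lin_closed Z -> (forall g : germ2 R, vanish p q K g -> Z g) ->
  (forall i j, Z (gmon R i j)) -> forall g, Z g.
Proof.
move=> p0 q0 HZ ZK Zm g; apply: (@vanish_fill p q K 0) => // i j _.
exists (gmon R i j), 1; split; rewrite ?oner_eq0 // scale1r subrr.
exact: gvanish0.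
Qed.

Lemma vanish_eq p q (a b : germ2 R) : (0 < p)%N -> (0 < q)%N ->
  (forall K, vanish p q K (a - b)) -> a = b.
Proof.
move=> p0 q0 v; apply: germ2_eqP => i j.
exact: (vanish_sub0 (v (p * i + q * j).+1)).
Qed.

End Filling.

Section Shift.
Variable R : realType.
Local Notation C := R[i].
Implicit Types a b : germ2 R.

(** The series a(x, y + al x^k): [t] counts the factors al x^k picked in the binomial expansion of
    (y + al x^k)^(J + t). For [k > 0] the condition k t <= I already forces t <= I. *)
Definition shift_coef (k : nat) (al : C) (a : nat -> nat -> C) : fps2 C := fun I J =>
  \sum_(t < I.+1) if (k * t <= I)%N
     then a (I - k * t)%N (J + t)%N * al ^+ t *+ 'C(J + t, t) else 0.

Lemma bin_le_exp n t : ('C(n, t) <= 2 ^ n)%N.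
Proof.
have [tn|nt] := leqP t n; last by rewrite bin_small.
rewrite -[2%N]/(1 + 1)%N expnDn (bigD1 (inord t)) //= inordK // !exp1n !muln1.
exact: leq_addr.
Qed.

Fact convergent2_shift k al a : (0 < k)%N -> shift_coef k al a \in @convergent2 R.
Proof.
move=> k0; have /convergent2_geomP[M [rho [rho1 H]]] := germ2P a.
have M0 : 0 <= M by have := H 0%N 0%N; rewrite expr0 mulr1; apply: le_trans (normc_ge0 _).
pose A := Num.max 1 (normc al).
have A1 : 1 <= A by rewrite le_max lexx.
have Aal : normc al <= A by rewrite le_max lexx orbT.
have A0 : 0 <= A by apply: le_trans A1.
have rho0 : 0 <= rho by apply: le_trans rho1.
have T0 : 0 <= 2 * (A * rho) by rewrite !mulr_ge0.
(* One factor 2 pays for the binomial coefficients, the other for the [I.+1] summands. *)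
apply/convergent2_geomP; exists M, (2 * (2 * (A * rho))); split=> [|I J].
  by rewrite !mulr_ege1 ?ler1n.
apply: le_trans (normc_sum _ _ _) _.
apply: le_trans (_ : \sum_(t < I.+1) M * (2 * (A * rho)) ^+ (I + J) <= _).
  apply: ler_sum => t _; case: ifP => [kt|_]; last first.
    by rewrite normc0 mulr_ge0 ?exprn_ge0.
  have tI : (t <= I)%N by rewrite -ltnS.
  rewrite -mulr_natr !normcM normcX normc_natr !exprMn.
  apply: le_trans (_ : M * rho ^+ (I + J) * A ^+ (I + J) * 2 ^+ (I + J) <= _); last first.
    by rewrite le_eqVlt; apply/orP; left; apply/eqP; ring.
  apply: ler_pM; rewrite ?mulr_ge0 ?normc_ge0 ?exprn_ge0 ?normc_ge0 //.
    apply: ler_pM; rewrite ?normc_ge0 ?exprn_ge0 ?normc_ge0 //.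
      apply: le_trans (H _ _) _; rewrite ler_wpM2l // ler_weXn2l //.
      have : (t <= k * t)%N by rewrite leq_pmull.
      lia.
    apply: le_trans (_ : A ^+ t <= _).
      by rewrite lerXn2r ?nnegrE ?normc_ge0.
    by rewrite ler_weXn2l // (leq_trans tI) ?leq_addr.
  rewrite -natrX ler_nat (leq_trans (bin_le_exp _ _)) // leq_exp2l //.
  by rewrite addnC leq_add2r.
rewrite big_const_ord iter_addr_0 -mulrnAr ler_wpM2l // -mulr_natl [leRHS]exprMn.
rewrite ler_wpM2r ?exprn_ge0 //.
by rewrite -natrX ler_nat (leq_trans (ltn_expl I (ltnSn 1))) // leq_exp2l ?leq_addr.
Qed.

Section FixedShift.
Variables (k : nat) (k0 : (0 < k)%N).

Definition gshift (al : C) a : germ2 R := Germ2 (convergent2_shift al a k0).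

Arguments gshift : simpl never.

(** The free bound [N] lets the sums on both sides of an identity run over the same range. *)
Lemma gshiftE al a N I J : (I < N)%N -> gshift al a I J =
  \sum_(t < N) if (k * t <= I)%N
     then a (I - k * t)%N (J + t)%N * al ^+ t *+ 'C(J + t, t) else 0.
Proof.
move=> IN; rewrite -[LHS]/(shift_coef k al a I J) /shift_coef.
rewrite (big_ord_widen _ (fun t : nat => if (k * t <= I)%N
     then a (I - k * t)%N (J + t)%N * al ^+ t *+ 'C(J + t, t) else 0) IN).
rewrite big_mkcond; apply: eq_bigr => t _; case: ltnP => // It.
by rewrite ifF //; apply: negbTE; rewrite -ltnNge (leq_trans It) // leq_pmull.
Qed.

Lemma gshift_lin al c a b : gshift al (c *: a + b) = c *: gshift al a + gshift al b.
Proof.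
apply: germ2_eqP => I J; rewrite germ2_coefD germ2_coefZ.
rewrite !(@gshiftE _ _ I.+1) // mulr_sumr -big_split; apply: eq_bigr => t _ /=.
case: ifP => _; last by rewrite mulr0 addr0.
rewrite -[(_ + _ : fps2 _) _ _]/(c * a (I - k * t)%N (J + t)%N + b (I - k * t)%N (J + t)%N).
by rewrite mulrDl mulrnDl -mulrA mulrnAr.
Qed.

Lemma gshiftD al a b : gshift al (a + b) = gshift al a + gshift al b.
Proof. by rewrite -[a]scale1r gshift_lin !scale1r. Qed.

Lemma gshift0 al : gshift al 0 = 0.
Proof. by have := gshift_lin al (-1) 0 0; rewrite !scaleN1r !addNr. Qed.

Lemma gshiftZ al c a : gshift al (c *: a) = c *: gshift al a.
Proof. by rewrite -[c *: a]addr0 gshift_lin gshift0 addr0. Qed.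

Lemma gshift_xM al a : gshift al (gmon R 1 0 * a) = gmon R 1 0 * gshift al a.
Proof.
apply: germ2_eqP => I J; rewrite gmon_mulE leq0n andbT subn0.
case: I => [|I].
  rewrite (@gshiftE _ _ 1) // big_ord_recl big_ord0 gmon_mulE.
  by rewrite muln0 subn0 mul0r mul0rn addr0.
rewrite ltn0Sn subn1 succnK (@gshiftE _ _ I.+2) // (@gshiftE _ _ I.+2) //.
apply: eq_bigr => t _; rewrite gmon_mulE andbT subn0.
have [kI|kI] := leqP (k * t)%N I; first by rewrite (leqW kI) subn_gt0 ltnS kI subSn // subn1.
by case: ifP => // kI1; rewrite subn_gt0 ltnS leqNgt kI mul0r mul0rn.
Qed.

Lemma gshift_yM al a : gshift al (gmon R 0 1 * a) =
  (gmon R 0 1 + al *: gmon R k 0) * gshift al a.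
Proof.
rewrite mulrDl -scalerAl; apply: germ2_eqP => I J.
rewrite germ2_coefD germ2_coefZ !gmon_mulE !leq0n andTb andbT !subn0 subn1.
rewrite (@gshiftE _ _ I.+2) //; under eq_bigr do rewrite gmon_mulE leq0n andTb subn0 subn1.
have := gshiftE al a; move: (gshift al a) => b bE.
rewrite big_ord_recl /= muln0 leq0n [in RHS](bE I.+2) // [in RHS]big_ord_recl /= muln0 leq0n.
rewrite !addn0 !bin0 !expr0 !mulr1 !mulr1n subn0.
(* Pascal's rule splits each coefficient into the contribution of y and that of al x^k. *)
transitivity ((if (0 < J)%N then a I J.-1 else 0) + \sum_(t < I.+1)
  ((if (0 < J)%N && (k * t.+1 <= I)%N then
     a (I - k * t.+1)%N (J + t)%N * al ^+ t.+1 *+ 'C(J + t, t.+1) else 0) +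
   (if (k * t.+1 <= I)%N then
     a (I - k * t.+1)%N (J + t)%N * al ^+ t.+1 *+ 'C(J + t, t) else 0))).
  congr (_ + _); apply: eq_bigr => t _; rewrite /bump leq0n add1n.
  case: (leqP (k * t.+1) I) => _; rewrite ?andbF ?addr0 // andbT.
  rewrite addnS /= binS mulrnDr.
  case: (posnP J) => [->|//]; by rewrite add0n bin_small ?mulr0n.
rewrite big_split /= addrA; congr (_ + _).
  case: (posnP J) => [->|J0] /=; first by rewrite big1 ?addr0.
  congr (_ + _); apply: eq_bigr => t _; rewrite /bump leq0n add1n.
  case: ifP => //; by rewrite addnS -{2}(prednK J0) addSn -{1}(prednK J0) addSn.
case: (leqP k I) => kI; last first.
  rewrite mulr0 big1 // => t _; rewrite ifF //; apply: negbTE.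
  by rewrite -ltnNge (leq_trans kI) // leq_pmulr.
rewrite (bE I.+1) ?ltnS ?leq_subr // mulr_sumr; apply: eq_bigr => t _.
rewrite mulnS -leq_subRL // subnDA; case: ifP => _; last by rewrite mulr0.
by rewrite exprS mulrnAr mulrCA.
Qed.

Lemma gshift1 al : gshift al 1 = 1.
Proof.
apply: germ2_eqP => I J; rewrite germ2_coef1 (@gshiftE _ _ I.+1) // big_ord_recl.
rewrite /= muln0 leq0n subn0 addn0 bin0 expr0 mulr1 mulr1n big1 ?addr0 // => t _.
rewrite /bump leq0n add1n; case: ifP => // _.
rewrite -[(_ : fps2 _) _ _]/(((I - k * t.+1 == 0)%N && (J + t.+1 == 0)%N)%:R : C).
by rewrite addnS andbF mul0r mul0rn.
Qed.

Lemma gshift_xMn al i a : gshift al (gmon R i 0 * a) = gmon R i 0 * gshift al a.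
Proof.
elim: i => [|i IH]; first by rewrite gmon00 !mul1r.
by rewrite -[i.+1]addn1 -[0%N]addn0 addnC -gmonM -!mulrA gshift_xM IH.
Qed.

Lemma gshift_vanish al K a : vanish 1 1 K a -> vanish 1 1 K (gshift al a).
Proof.
move=> va I J; rewrite !mul1n => IJ; rewrite (@gshiftE _ _ I.+1) // big1 // => t _.
case: ifP => // kt; rewrite va ?mul0r ?mul0rn // !mul1n.
have : (t <= k * t)%N by rewrite leq_pmull.
by lia.
Qed.

Lemma gmonSy i j : gmon R i j.+1 = gmon R 0 1 * gmon R i j.
Proof. by rewrite gmonM. Qed.

(** Convolutions of binomial sums are avoided: the claim is linear in [a], so monomials suffice, and
    these are built up by the rules for multiplication by x and by y. *)
Lemma gshiftM al a b : gshift al (a * b) = gshift al a * gshift al b.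
Proof.
apply: (@vanish_eq _ 1 1) => // K; move: a b.
pose Z a := forall b, vanish 1 1 K (gshift al (a * b) - gshift al a * gshift al b).
have HZ : lin_closed Z.
  split=> [b|c u v Zu Zv b]; first by rewrite mul0r !gshift0 mul0r subrr.
  rewrite gshift_lin !mulrDl -!scalerAl gshift_lin opprD addrACA -scalerBr.
  by apply: gvanishD; [exact/gvanishZ/Zu|exact: Zv].
apply: (@vanish_dense _ 1 1 K Z) => // [g vg b|i j b].
  have vM u v : vanish 1 1 K (germ2_fps u) -> vanish 1 1 K (germ2_fps (u * v : germ2 R)).
    by move=> vu; rewrite mulrC; apply: gvanishMl.
  by apply: gvanishB; [apply/gshift_vanish/vM|apply/vM/gshift_vanish].
suff -> : gshift al (gmon R i j * b) = gshift al (gmon R i j) * gshift al b.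
  by rewrite subrr.
elim: j b => [|j IH] b.
  rewrite gshift_xMn -[gmon R i 0 in RHS]mulr1 gshift_xMn gshift1.
  by rewrite mulr1.
by rewrite gmonSy -mulrA !gshift_yM IH mulrA.
Qed.

Lemma gshiftK al : cancel (gshift al) (gshift (- al)).
Proof.
move=> a; apply: (@vanish_eq _ 1 1) => // K; move: a.
pose phi a := gshift (- al) (gshift al a).
apply: (@vanish_dense _ 1 1 K (fun a => vanish 1 1 K (phi a - a))) => //.
- split=> [|c u v Hu Hv]; first by rewrite /phi !gshift0 subrr.
  rewrite /phi !gshift_lin opprD addrACA -scalerBr.
  by apply: gvanishD => //; apply: gvanishZ.
- by move=> g vg; apply: gvanishB => //; do 2!apply: gshift_vanish.
move=> i j; suff -> : phi (gmon R i j) = gmon R i j by rewrite subrr.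
elim: j => [|j IH].
  by rewrite -[gmon R i 0]mulr1 /phi !gshift_xMn !gshift1.
rewrite gmonSy /phi gshift_yM mulrDl gshiftD gshift_yM -scalerAl gshiftZ gshift_xMn.
rewrite -/(phi _) IH mulrDl -scalerAl scaleNr addrNK //.
Qed.

Lemma dyE a i j : dy a i j = a i j.+1 *+ j.+1. Proof. by []. Qed.
Lemma dxE a i j : dx a i j = a i.+1 j *+ i.+1. Proof. by []. Qed.

Lemma dy_gshift al a : dy (gshift al a) = gshift al (dy a).
Proof.
apply: germ2_eqP => I J.
rewrite -[LHS]/(gshift al a I J.+1 *+ J.+1) !(@gshiftE _ _ I.+1) // -sumrMnl.
apply: eq_bigr => t _; case: ifP => _; last by rewrite mul0rn.
rewrite dyE addSn mulrnAl -!mulrnA; congr (_ *+ _).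
have := mul_bin_down (J + t).+1 t; rewrite subSn ?leq_addl // addnK /= => e.
by rewrite mulnC -e.
Qed.

(** Chain rule: the factor [I.+1] splits as [(I.+1 - k * t) + k * t], the first part differentiating
    [a] in x, the second the inner al x^k. *)
Lemma dx_gshift al a : dx (gshift al a) =
  gshift al (dx a) + (k%:R * al) *: gmon R k.-1 0 * gshift al (dy a).
Proof.
apply: germ2_eqP => I J; rewrite germ2_coefD -scalerAl germ2_coefZ gmon_mulE andbT subn0.
rewrite -[LHS]/(gshift al a I.+1 J *+ I.+1) (@gshiftE _ a I.+2) // -sumrMnl.
transitivity (\sum_(t < I.+2) (
  (if (k * t <= I)%N then a (I - k * t).+1 (J + t)%N *+ (I - k * t).+1 * al ^+ t *+ 'C(J + t, t) else 0) +
  (if (k * t <= I.+1)%N then a (I.+1 - k * t)%N (J + t)%N * al ^+ t *+ 'C(J + t, t) *+ (k * t) else 0))).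
  apply: eq_bigr => t _; have [ktI|Ikt] := leqP (k * t)%N I.
    rewrite (leqW ktI) -subSn // mulrnAl -!mulrnA -mulrnDr; congr (_ *+ _).
    by rewrite (mulnC (_ - _)%N) -mulnDr subnK // leqW.
  rewrite add0r; case: ifP => kt; last by rewrite mul0rn.
  by congr (_ *+ _); apply/eqP; rewrite eqn_leq Ikt kt.
rewrite big_split; congr (_ + _); first by rewrite (@gshiftE _ _ I.+2).
have := gshiftE al (dy a); move: (gshift al (dy a)) => b bE.
rewrite big_ord_recl /= muln0 /= mulr0n add0r.
case: leqP => kI; last first.
  rewrite mulr0 big1 // => t _; rewrite /bump leq0n add1n ifF //; apply: negbTE; rewrite -ltnNge.
  by apply: (@leq_trans k); [lia|rewrite leq_pmulr].
rewrite (bE I.+1) ?ltnS ?leq_subr // mulr_sumr; apply: eq_bigr => t _.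
rewrite /bump leq0n add1n.
have kE : k = k.-1.+1 by rewrite prednK.
have -> : (k * t.+1 <= I.+1)%N = (k * t <= I - k.-1)%N.
  by rewrite mulnS {1}kE addSn ltnS -leq_subRL.
case: ifP => kt; last by rewrite mulr0.
have -> : (I.+1 - k * t.+1 = I - k.-1 - k * t)%N.
  by rewrite mulnS {1}kE addSn subSS subnDA.
rewrite dyE addnS exprS; set u := a _ _.
rewrite mulr_natl mulrnAl mulrnAl mulrnAr -!mulrnA mulrnAr -mulrnA (mulrCA al).
congr (_ *+ _); transitivity (k * ((J + t).+1 * 'C(J + t, t)))%N; last by ring.
by rewrite (mul_bin_diag (J + t).+1 t); ring.
Qed.

End FixedShift.
End Shift.

(** * Transport along automorphisms *)

Section Transport.
Variable R : realType.
Implicit Types (f g h : germ2 R) (s : seq (germ2 R)).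

Lemma quot_dim_ext (K : fieldType) (A : lmodType K) (I J : set A) d :
  (forall x, I x <-> J x) -> quot_dim I d -> quot_dim J d.
Proof.
move=> IJ; suff -> : I = J by [].
by apply/funext => x; apply/propext.
Qed.

Record germ_iso (th th' : germ2 R -> germ2 R) : Prop := GermIso {
  iso_lin : forall c a b, th (c *: a + b) = c *: th a + th b;
  isoM : forall a b, th (a * b) = th a * th b;
  isoK : cancel th th';
  isoVK : cancel th' th }.

Lemma germ_iso_sym th th' : germ_iso th th' -> germ_iso th' th.
Proof.
move=> [lin mul K VK]; split=> // [c a b|a b]; apply: (can_inj K).
  by rewrite lin !VK.
by rewrite mul !VK.
Qed.

Section Iso.
Variables (th th' : germ2 R -> germ2 R) (iso : germ_iso th th').

Lemma iso_add a b : th (a + b) = th a + th b.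
Proof. by rewrite -[a]scale1r (iso_lin iso) !scale1r. Qed.

Lemma iso0 : th 0 = 0.
Proof. by have := iso_lin iso (-1) 0 0; rewrite !scaleN1r !addNr. Qed.

Lemma iso_scale c a : th (c *: a) = c *: th a.
Proof. by rewrite -[c *: a]addr0 (iso_lin iso) iso0 addr0. Qed.

Lemma iso_opp a : th (- a) = - th a.
Proof. by rewrite -scaleN1r iso_scale scaleN1r. Qed.

Lemma iso_sum I (r : seq I) (P : pred I) (F : I -> germ2 R) :
  th (\sum_(i <- r | P i) F i) = \sum_(i <- r | P i) th (F i).
Proof. by elim/big_rec2: _ => [|i u v _ <-]; rewrite ?iso0 ?iso_add. Qed.

Lemma iso1 : th 1 = 1.
Proof. by rewrite -[LHS]mul1r -{1}[1](isoVK iso) -(isoM iso) mulr1 (isoVK iso). Qed.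

Lemma iso_unit f : f \is a GRing.unit -> th f \is a GRing.unit.
Proof. by move=> /unitrPr[g fg]; apply/unitrPr; exists (th g); rewrite -(isoM iso) fg iso1. Qed.

Lemma iso_gen s g : gen_ideal s g -> gen_ideal (map th s) (th g).
Proof.
move=> [c ->]; exists (fun i => th (c i)); rewrite size_map iso_sum.
by apply: eq_bigr => i _; rewrite (isoM iso) (nth_map 0).
Qed.

Lemma iso_divides f g : divides f g -> divides (th f) (th g).
Proof. by move=> [h ->]; exists (th h); rewrite (isoM iso). Qed.

End Iso.

Section Transfer.
Variables (th th' : germ2 R -> germ2 R) (iso : germ_iso th th').
Let iso' := germ_iso_sym iso.

Lemma iso_map_K s : map th' (map th s) = s.
Proof. by rewrite -map_comp -[RHS]map_id; apply: eq_map => g; exact: (isoK iso). Qed.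

Lemma iso_quot_dim s d :
  quot_dim (gen_ideal s) d -> quot_dim (gen_ideal (map th s)) d.
Proof.
have HI := gen_ideal_lin s; have HI' := gen_ideal_lin (map th s).
move=> /(quot_dimP _ HI)[b [indep gen]]; apply/(quot_dimP _ HI').
exists (th \o b); split=> [c Hc|g].
  apply: indep; have := iso_gen iso' Hc.
  rewrite iso_map_K (iso_sum iso'); congr (gen_ideal s _).
  by apply: eq_bigr => i _; rewrite (iso_scale iso') /= (isoK iso).
have [c Hc] := gen (th' g); exists c.
have := iso_gen iso Hc; rewrite (iso_add iso) (isoVK iso) (iso_opp iso) (iso_sum iso).
by congr (gen_ideal _ (_ - _)); apply: eq_bigr => i _; rewrite (iso_scale iso).
Qed.

Lemma iso_irreducible f : irreducible_elt f -> irreducible_elt (th f).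
Proof.
move=> [f0 fu irr]; split.
- by apply: contra f0 => /eqP e; rewrite -(isoK iso f) e (iso0 iso').
- by apply: contra fu => /(iso_unit iso'); rewrite (isoK iso).
move=> g h e; have : f = th' g * th' h by rewrite -(isoM iso') -e (isoK iso).
by case/irr => /(iso_unit iso); rewrite (isoVK iso); [left|right].
Qed.

Lemma iso_semigroup_sub f : (semigroup_of f `<=` semigroup_of (th f))%classic.
Proof.
move=> k [h nd Hk]; exists (th h).
  by move=> /(iso_divides iso'); rewrite !(isoK iso).
exact: (iso_quot_dim Hk).
Qed.

End Transfer.

(** What a change of coordinates carries along; the order of [f] at the origin is followed
    separately by [vanish 1 1 2]. *)
Definition branch_data f n m mu tau : Prop :=
  [/\ irreducible_elt f, single_puiseux_pair f n m, milnor_number f mu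
    & tjurina_number f tau].

(** Irreducibility and intersection numbers are intrinsic to the algebra, whereas [mu] and [tau]
    involve the partial derivatives; hence the hypothesis on the Jacobian ideal. *)
Lemma branch_data_iso th th' f n m mu tau : germ_iso th th' ->
  (forall g, gen_ideal [:: th (dx f); th (dy f)] g <->
             gen_ideal [:: dx (th f); dy (th f)] g) ->
  branch_data f n m mu tau -> branch_data (th f) n m mu tau.
Proof.
move=> iso jac [irr [nm co sg] Hmu Htau]; split.
- exact: iso_irreducible iso _ irr.
- split=> //; rewrite -sg; apply/seteqP; split; last exact: iso_semigroup_sub iso f.
  by have := iso_semigroup_sub (germ_iso_sym iso) (f := th f); rewrite (isoK iso).
- by apply: quot_dim_ext jac _; apply: (iso_quot_dim iso Hmu).
apply: quot_dim_ext (iso_quot_dim iso Htau) => g; rewrite /= !gen_ideal3P.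
have jac2 := jac; split=> -[u [v [w e]]].
  have /jac/gen_ideal2P[v' [w' e']] : gen_ideal [:: th (dx f); th (dy f)] (v * th (dx f) + w * th (dy f)).
    by apply/gen_ideal2P; exists v, w.
  by exists u, v', w'; rewrite e -addrA e' addrA.
have /jac/gen_ideal2P[v' [w' e']] : gen_ideal [:: dx (th f); dy (th f)] (v * dx (th f) + w * dy (th f)).
  by apply/gen_ideal2P; exists v, w.
by exists u, v', w'; rewrite e -addrA e' addrA.
Qed.

Definition gswap f : germ2 R := Germ2 (convergent2_swap (germ2P f)).

Lemma gswapE f i j : gswap f i j = f j i. Proof. by []. Qed.

Lemma gswap_iso : germ_iso gswap gswap.
Proof.
split=> [c a b|a b|a|a]; apply: germ2_eqP => i j //.
rewrite gswapE !germ2_fpsM !fps2_mulE exchange_big.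
by apply: eq_bigr => s _; apply: eq_bigr => t _.
Qed.

Lemma branch_data_swap f n m mu tau :
  branch_data f n m mu tau -> branch_data (gswap f) n m mu tau.
Proof.
apply: branch_data_iso gswap_iso _ => g.
have -> : dx (gswap f) = gswap (dy f) by apply: germ2_eqP.
have -> : dy (gswap f) = gswap (dx f) by apply: germ2_eqP.
by rewrite !gen_ideal2P; split=> -[u [v ->]]; exists v, u; rewrite addrC.
Qed.

Lemma gshift_iso k (k0 : (0 < k)%N) al :
  germ_iso (gshift k0 al) (gshift k0 (- al)).
Proof.
split; [exact: gshift_lin|exact: gshiftM|exact: gshiftK|].
by move=> a; rewrite -{1}[al]opprK gshiftK.
Qed.

Lemma branch_data_shift k (k0 : (0 < k)%N) al f n m mu tau :
  branch_data f n m mu tau -> branch_data (gshift k0 al f) n m mu tau.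
Proof.
apply: branch_data_iso (gshift_iso k0 al) _ => g.
rewrite dx_gshift dy_gshift !gen_ideal2P; split=> -[u [v ->]].
  exists u, (v - u * ((k%:R * al) *: gmon R k.-1 0)); ring.
exists u, (v + u * ((k%:R * al) *: gmon R k.-1 0)); ring.
Qed.

End Transport.

(** * Dimension bounds by weighted monomials *)

Definition pair_box (r s : nat) : seq (nat * nat) :=
  [seq (i, j) | i <- iota 0 r, j <- iota 0 s].

Lemma mem_pair_box r s u : (u \in pair_box r s) = (u.1 < r)%N && (u.2 < s)%N.
Proof.
case: u => i j; apply/allpairsP/idP => [[[i' j'] /= []]|/andP[/= ir js]].
  by rewrite !mem_iota !add0n => /andP[_ ir] /andP[_ js] [-> ->]; rewrite ir js.
by exists (i, j); rewrite !mem_iota.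
Qed.

Lemma uniq_pair_box r s : uniq (pair_box r s).
Proof. by apply: allpairs_uniq; rewrite ?iota_uniq // => -[? ?] [? ?]. Qed.

Lemma size_pair_box r s : size (pair_box r s) = (r * s)%N.
Proof. by rewrite size_allpairs !size_iota. Qed.

Section WeightedTriangle.
Variables p q : nat.
Hypotheses (p0 : (0 < p)%N) (q0 : (0 < q)%N).
Local Notation wt u := (p * u.1 + q * u.2)%N.

(** Exponents of the monomial basis of the germs modulo weight [W]. *)
Definition triangle (W : nat) : seq (nat * nat) :=
  [seq u <- pair_box W W | (wt u < W)%N].

Lemma mem_triangle W u : (u \in triangle W) = (wt u < W)%N.
Proof.
rewrite mem_filter mem_pair_box; case: ltnP => // lt /=; apply/andP.
by split; apply: leq_ltn_trans lt; [apply: (leq_trans (leq_pmull _ p0)); rewrite leq_addr|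
  apply: (leq_trans (leq_pmull _ q0)); rewrite leq_addl].
Qed.

Lemma uniq_triangle W : uniq (triangle W).
Proof. by rewrite filter_uniq ?uniq_pair_box. Qed.

Variable R : realType.
Local Notation C := R[i].
Local Notation van k := (fun g : germ2 R => vanish p q k g).

Lemma triangle_indep W (c : 'I_(size (triangle W)) -> C) :
  vanish p q W (\sum_i c i *: gmon R (nth (0, 0)%N (triangle W) i).1
                                     (nth (0, 0)%N (triangle W) i).2 : germ2 R) ->
  forall i, c i = 0.
Proof.
set L := triangle W in c * => v i; set u := nth (0, 0)%N L i.
have uW : (wt u < W)%N by rewrite -mem_triangle mem_nth.
have := v _ _ uW; rewrite germ2_coef_sum (bigD1 i) //= big1 => [|j ji].
  by rewrite addr0 fps2_coefZ /fps2_mon !eqxx mulr1.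
rewrite fps2_coefZ /fps2_mon -/u.
case: andP => [[/eqP e1 /eqP e2]|_]; last by rewrite mulr0.
suff e : i = j by rewrite e eqxx in ji.
apply: val_inj; apply/eqP; rewrite -(nth_uniq (0, 0)%N (ltn_ord i) (ltn_ord j) (uniq_triangle W)).
by rewrite -/L -/u [u]surjective_pairing e1 e2 -surjective_pairing.
Qed.

Lemma triangle_codim W (I : set (germ2 R)) d S :
  lin_closed I -> quot_dim I d -> (forall g, I g -> inspan (van W) S g) ->
  (size (triangle W) <= d + size S)%N.
Proof.
move=> HI Hd IS; apply: (quot_dim_ge (@vanish_lin R p q W) HI Hd _ IS).
exact: triangle_indep.
Qed.

(** Modulo weight [W] the ideal is spanned by the multiples of [h] by monomials of weight below
    [W - q]. The triangle of size [W] contains that smaller triangle multiplied by y and, disjoint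
    from it, the powers 1, ..., x^(c - 1). *)
Lemma quot_dim_ge_edge (f h : germ2 R) W d c :
  vanish p q W f -> vanish p q q h -> quot_dim (gen_ideal [:: f; h]) d ->
  (forall i, (i < c)%N -> (p * i < W)%N) -> (c <= d)%N.
Proof.
move=> vf vh Hd cW.
pose S := [seq gmon R u.1 u.2 * h | u <- triangle (W - q)].
have HV := @vanish_lin R p q W; have HZ := inspan_lin S HV.
have vI (g : germ2 R) : vanish p q W g -> inspan (van W) S g.
  by move=> vg; apply: (inspan_mod S HV).
have key g : gen_ideal [:: f; h] g -> inspan (van W) S g.
  move=> /gen_ideal2P[u [v ->]].
  apply: (lin_closedD HZ); first exact: vI _ (gvanishMl u vf).
  move: v; apply: (@vanish_dense _ p q W (fun v => inspan (van W) S (v * h)) p0 q0).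
  - split=> [|c' a b Ha Hb]; first by rewrite mul0r; case: HZ.
    rewrite mulrDl -scalerAl; exact: lin_closedD HZ (lin_closedZ c' HZ Ha) Hb.
  - by move=> v vv; exact: vI _ (gvanishMr h vv).
  move=> i j; have [ij|ij] := ltnP (p * i + q * j) (W - q).
    apply: (inspan_mem HV); apply/mapP; exists (i, j) => //.
    by rewrite mem_triangle.
  apply: vI; apply: (@vanish_le _ p q (p * i + q * j + q)); first by lia.
  exact: gvanishM (@gvanish_mon R p q i j) vh.
have := triangle_codim (gen_ideal_lin [:: f; h]) Hd key; rewrite size_map => H.
rewrite -(leq_add2r (size (triangle (W - q)))); apply: leq_trans H.
rewrite addnC -[X in (_ + X <= _)%N](size_iota 0 c).
have <- : size ([seq (v.1, v.2.+1) | v <- triangle (W - q)] ++ [seq (i, 0%N) | i <- iota 0 c]) =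
  (size (triangle (W - q)) + size (iota 0 c))%N by rewrite size_cat !size_map.
apply: uniq_leq_size => [|[i j]].
  rewrite cat_uniq !map_inj_uniq ?uniq_triangle ?iota_uniq //=.
  - by rewrite andbT; apply/hasPn => _ /mapP[i _ ->]; apply/mapP => -[].
  - by move=> i j [].
  by move=> [? ?] [? ?] [-> ->].
rewrite mem_cat mem_triangle => /orP[|] /mapP[].
  by move=> [s t]; rewrite mem_triangle /= => H' [-> ->]; rewrite mulnS; lia.
by move=> s; rewrite mem_iota add0n /= => sc [-> ->]; rewrite muln0 addn0 cW.
Qed.

(** * Two generators whose initial forms are pure powers of x and y *)

Section CompleteIntersection.
Variables (P Q : germ2 R) (r s : nat) (lu lv : C).
Hypotheses (lu0 : lu != 0) (lv0 : lv != 0).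
Hypothesis vP : vanish p q (p * r).+1 (P - lu *: gmon R r 0).
Hypothesis vQ : vanish p q (q * s).+1 (Q - lv *: gmon R 0 s).

Let nonbox (u : nat * nat) := (r <= u.1)%N || (s <= u.2)%N.

(* One element with leading term [x^i y^j] for each [(i, j)]: a triangular basis
   in which the ideal [(P, Q)] is spanned by the elements outside the box. *)
Definition lead_mon (u : nat * nat) : germ2 R :=
  if (r <= u.1)%N then gmon R (u.1 - r) u.2 * P
  else if (s <= u.2)%N then gmon R u.1 (u.2 - s) * Q else gmon R u.1 u.2.

Lemma vanish_leadP : vanish p q (p * r) P.
Proof.
rewrite -[P](subrK (lu *: gmon R r 0)); apply: gvanishD.
  exact: vanish_le (leqnSn _) vP.
by apply: gvanishZ; have := @gvanish_mon R p q r 0; rewrite muln0 addn0.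
Qed.

Lemma vanish_leadQ : vanish p q (q * s) Q.
Proof.
rewrite -[Q](subrK (lv *: gmon R 0 s)); apply: gvanishD.
  exact: vanish_le (leqnSn _) vQ.
by apply: gvanishZ; have := @gvanish_mon R p q 0 s; rewrite muln0.
Qed.

Lemma lead_P i j : vanish p q (p * (i + r) + q * j).+1
  (gmon R i j * P - lu *: gmon R (i + r) j).
Proof.
have -> : gmon R (i + r) j = gmon R i j * gmon R r 0 by rewrite gmonM addn0.
rewrite scalerAr -mulrBr mulnDr addnAC -addnS.
exact: gvanishM (@gvanish_mon R p q i j) vP.
Qed.

Lemma lead_Q i j : vanish p q (p * i + q * (j + s)).+1
  (gmon R i j * Q - lv *: gmon R i (j + s)).
Proof.
have -> : gmon R i (j + s) = gmon R i j * gmon R 0 s by rewrite gmonM addn0.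
rewrite scalerAr -mulrBr mulnDr addnA -addnS.
exact: gvanishM (@gvanish_mon R p q i j) vQ.
Qed.

Lemma lead_monP u : exists2 c, c != 0 &
  vanish p q (wt u).+1 (lead_mon u - c *: gmon R u.1 u.2).
Proof.
rewrite /lead_mon; case: leqP => ru.
  by exists lu => //; have := @lead_P (u.1 - r) u.2; rewrite subnK.
case: leqP => su.
  by exists lv => //; have := @lead_Q u.1 (u.2 - s); rewrite subnK.
by exists 1; rewrite ?oner_eq0 // scale1r subrr.
Qed.

Lemma lead_fill K k (Z : germ2 R -> Prop) : lin_closed Z ->
  (forall g, van K g -> Z g) ->
  (forall u, (k <= wt u < K)%N -> Z (lead_mon u)) -> forall g, van k g -> Z g.
Proof.
move=> HZ ZK ZE; apply: (vanish_fill p0 q0 HZ ZK) => i j ij.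
have [c c0 vE] := lead_monP (i, j); exists (lead_mon (i, j)), c.
by split=> //; apply: ZE.
Qed.

(** In u P + v Q the multiplier v may avoid monomials divisible by x^r: these are leading terms of
    multiples of [P], and a multiple of [P] times [Q] is already accounted for by [P]. What is left
    are the [lead_mon] outside the box. *)
Lemma lead_ideal K (Z : germ2 R -> Prop) : lin_closed Z ->
  (forall g, van K g -> Z g) ->
  (forall u, nonbox u -> (wt u < K)%N -> Z (lead_mon u)) ->
  forall g, gen_ideal [:: P; Q] g -> Z g.
Proof.
move=> HZ ZK ZE.
have lin (T : germ2 R) : lin_closed (fun a => Z (a * T)).
  split=> [|c a b Ha Hb]; first by rewrite mul0r; case: HZ.
  rewrite mulrDl -scalerAl; exact: lin_closedD HZ (lin_closedZ c HZ Ha) Hb.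
have vT (T a : germ2 R) : vanish p q K a -> Z (a * T).
  by move=> va; exact: ZK _ (gvanishMr T va).
have ZP a : Z (a * P).
  apply: (@vanish_dense _ p q K (fun a => Z (a * P)) p0 q0 (lin P) (vT P)) => i j.
  have [ij|ij] := ltnP (p * (i + r) + q * j) K.
    have := ZE (i + r, j)%N; rewrite /nonbox /lead_mon /= leq_addl addnK.
    by apply.
  apply: ZK; apply: vanish_le ij _; rewrite mulnDr addnAC.
  exact: gvanishM (@gvanish_mon R p q i j) vanish_leadP.
have ZQ a : Z (a * Q).
  apply: (@vanish_fill _ p q K 0 (fun a => Z (a * Q)) p0 q0 (lin Q) (vT Q)) => // i j _.
  have [ri|ir] := leqP r i.
    exists (gmon R (i - r) j * P), lu; split=> //; first by rewrite mulrAC.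
    by have := @lead_P (i - r) j; rewrite subnK.
  exists (gmon R i j), 1; rewrite oner_eq0 scale1r subrr; split=> //.
  have [ij|ij] := ltnP (p * i + q * (j + s)) K.
    have := ZE (i, j + s)%N; rewrite /nonbox /lead_mon /= leq_addl orbT addnK (leqNgt r) ir.
    by apply.
  apply: ZK; apply: vanish_le ij _; rewrite mulnDr addnA.
  exact: gvanishM (@gvanish_mon R p q i j) vanish_leadQ.
by move=> g /gen_ideal2P[u [v ->]]; exact: lin_closedD HZ (ZP u) (ZQ v).
Qed.

Lemma quot_dim_le_box d : quot_dim (gen_ideal [:: P; Q]) d -> (d <= r * s)%N.
Proof.
move=> Hd; have HI := gen_ideal_lin [:: P; Q].
have [K HK] := fin_codim_vanish p0 q0 Hd.
have -> : (r * s = size [seq gmon R u.1 u.2 | u <- pair_box r s])%N.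
  by rewrite size_map size_pair_box.
apply: (quot_dim_le_size HI Hd) => g.
apply: (@lead_fill K 0) => //; first exact: inspan_lin.
  by move=> h vh; apply: inspan_mod => //; apply: HK.
move=> u _; rewrite /lead_mon; case: leqP => ru.
  by apply: inspan_mod => //; apply/gen_ideal2P; exists (gmon R (u.1 - r) u.2), 0; rewrite mul0r addr0.
case: leqP => su.
  by apply: inspan_mod => //; apply/gen_ideal2P; exists 0, (gmon R u.1 (u.2 - s)); rewrite mul0r add0r.
by apply: inspan_mem => //; apply/mapP; exists u; rewrite ?mem_pair_box ?ru.
Qed.

Lemma pair_box_triangle u : u \in pair_box r s -> (wt u < (p * r + q * s).+1)%N.
Proof.
by rewrite mem_pair_box => /andP[ur us]; rewrite ltnS leq_add ?leq_mul2l ?(ltnW ur) ?(ltnW us) ?orbT.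
Qed.

Lemma count_box_triangle (a : pred (nat * nat)) K : (p * r + q * s < K)%N ->
  (count a (pair_box r s) <= count (fun u => ~~ nonbox u && a u) (triangle K))%N.
Proof.
move=> HK; rewrite -!size_filter uniq_leq_size ?filter_uniq ?uniq_pair_box // => u.
rewrite mem_filter => /andP[au uB]; rewrite mem_filter mem_triangle au andbT.
rewrite (leq_trans (pair_box_triangle uB)) // andbT /nonbox negb_or -!ltnNge.
by rewrite -mem_pair_box.
Qed.

(* Multiples of [f] by monomials of weight below [k] are counted by the triangle;
   modulo [(P, Q)] all the other multiples have weight above [k + D]. *)
Lemma quot_dim_ge_box f D k d :
  (exists2 g, gen_ideal [:: P; Q] g & vanish p q D.+1 (f - g)) ->
  quot_dim (gen_ideal [:: f; P; Q]) d ->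
  (r * s <= d + size (triangle k) +
      count (fun u => k + D < wt u)%N (pair_box r s))%N.
Proof.
move=> [g0 Hg0 vf] Hd.
(* All box monomials have weight below [K]. The predicate [a] selects the [lead_mon] that serve as
   generators: those in the ideal and those too heavy to be controlled. Steinitz bounds the number
   of the remaining ones, which include every box monomial of weight at most [k + D]. *)
pose K := (p * r + q * s).+1.
pose a u := nonbox u || (k + D < wt u)%N.
pose S := [seq lead_mon u | u <- triangle K & a u] ++
          [seq gmon R u.1 u.2 * f | u <- triangle k].
have HV := @vanish_lin R p q K; have HZ := inspan_lin S HV.
have ZK (g : germ2 R) : vanish p q K g -> inspan (van K) S g.
  by move=> vg; apply: (inspan_mod S HV).
have ZE u : (wt u < K)%N -> a u -> inspan (van K) S (lead_mon u).
  move=> uK au; apply: inspan_mem => //; rewrite mem_cat map_f //.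
  by rewrite mem_filter au mem_triangle.
have ZPQ g : gen_ideal [:: P; Q] g -> inspan (van K) S g.
  by apply: (@lead_ideal K) => // u nu uK; apply: ZE => //; rewrite /a nu.
have Zhigh u : (k + D.+1 <= wt u < K)%N -> inspan (van K) S (lead_mon u).
  by move=> /andP[ku uK]; apply: ZE => //; rewrite /a -addnS ku orbT.
have Zf b : inspan (van K) S (b * f).
  apply: (@vanish_dense _ p q k (fun b => inspan (van K) S (b * f)) p0 q0).
  - split=> [|c' x y Hx Hy]; first by rewrite mul0r; case: HZ.
    rewrite mulrDl -scalerAl; exact: lin_closedD HZ (lin_closedZ c' HZ Hx) Hy.
  - move=> x vx; rewrite -[f](subrK g0) mulrDr; apply: (lin_closedD HZ); last first.
      exact: ZPQ _ (gen_idealMl _ Hg0).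
    by apply: (lead_fill HZ ZK Zhigh); exact: gvanishM vx vf.
  move=> i j; have [ij|ij] := ltnP (p * i + q * j) k.
    apply: (inspan_mem HV); rewrite mem_cat; apply/orP; right.
    by apply/mapP; exists (i, j); rewrite ?mem_triangle.
  rewrite -[f](subrK g0) mulrDr; apply: (lin_closedD HZ); last first.
    exact: ZPQ _ (gen_idealMl _ Hg0).
  apply: (lead_fill HZ ZK Zhigh).
  exact: gvanishM (vanish_le ij (@gvanish_mon R p q i j)) vf.
have key g : gen_ideal [:: f; P; Q] g -> inspan (van K) S g.
  move=> /gen_ideal3P[x [y [z ->]]].
  rewrite -addrA; apply: (lin_closedD HZ (Zf x)); apply: ZPQ.
  by apply/gen_ideal2P; exists y, z.
have := triangle_codim (gen_ideal_lin [:: f; P; Q]) Hd key.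
rewrite size_cat !size_map size_filter.
rewrite -(count_predC a (triangle K)) => H.
have B := @count_box_triangle (fun u => wt u <= k + D)%N K (ltnSn _).
have E : (size (pair_box r s) = count (fun u => wt u <= k + D) (pair_box r s) +
    count (fun u => k + D < wt u) (pair_box r s))%N.
  rewrite -(count_predC (fun u => wt u <= k + D)%N); congr (_ + _)%N.
  by apply: eq_count => u /=; rewrite ltnNge.
have C' : count (fun u => ~~ nonbox u && (wt u <= k + D)%N) (triangle K) =
    count (predC a) (triangle K).
  by apply: eq_count => u; rewrite /a /= negb_or -leqNgt.
rewrite C' in B; rewrite -size_pair_box E leq_add2r; apply: leq_trans B _.
by rewrite -(leq_add2l (count a (triangle K))) addnCA; exact: H.
Qed.

(** The lower bound is [quot_dim_ge_box] for the repeated generator [f := P]: being in the ideal, it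
    allows [D] to exceed all box weights, and with [k = 0] both corrections vanish. *)
Lemma quot_dim_box d : quot_dim (gen_ideal [:: P; Q]) d -> d = (r * s)%N.
Proof.
move=> Hd; apply/eqP; rewrite eqn_leq quot_dim_le_box //=.
have Hd' : quot_dim (gen_ideal [:: P; P; Q]) d.
  apply: quot_dim_ext Hd => g; rewrite gen_ideal2P gen_ideal3P.
  split=> [[u [v ->]]|[u [v [w ->]]]].
    by exists 0, u, v; rewrite mul0r add0r.
  by exists (u + v), w; rewrite mulrDl.
have := @quot_dim_ge_box P (p * r + q * s) 0 d _ Hd'.
have -> : size (triangle 0) = 0%N by [].
rewrite addn0 (eq_in_count (a2 := pred0)) ?count_pred0 ?addn0.
  apply; exists P; last by rewrite subrr.
  by apply/gen_ideal2P; exists 1, 0; rewrite mul1r mul0r addr0.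
by move=> u /pair_box_triangle; rewrite ltnS add0n leqNgt => /negbTE.
Qed.

End CompleteIntersection.
End WeightedTriangle.

(** * The intersection number with the line y = 0 *)

Section IntersectionWithLine.
Variable R : realType.
Implicit Types f g : germ2 R.

(** Modulo y, [f] is x^c times a unit. Independence is seen with the weights (1, c), for which both
    generators vanish to weight [c] while x^i with i < c has weight i. *)
Lemma quot_dim_line f c : (forall i, (i < c)%N -> f i 0%N = 0) -> f c 0%N != 0 ->
  quot_dim (gen_ideal [:: f; gmon R 0 1]) c.
Proof.
move=> f0 fc; have HI := gen_ideal_lin [:: f; gmon R 0 1].
apply/(quot_dimP _ HI); exists (fun i : 'I_c => gmon R i 0).
have coef (a : 'I_c -> R[i]) k j : (\sum_i a i *: gmon R i 0) k j =
    \sum_(i < c) a i * ((k == i) && (j == 0%N))%:R.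
  by rewrite germ2_coef_sum.
split=> [a /gen_ideal2P[u [v E]] k|g].
  have v1 : vanish 1 c c (\sum_i a i *: gmon R i 0 : germ2 R).
    rewrite E; apply: gvanishD; apply: gvanishMl.
      move=> i [|j]; first by rewrite muln0 addn0 mul1n => /f0.
      by rewrite mulnS addnCA ltnNge leq_addr.
    by have := @gvanish_mon R 1 c 0 1; rewrite muln0 muln1.
  have := v1 k 0%N; rewrite mul1n muln0 addn0 ltn_ord coef (bigD1 k) //= !eqxx mulr1.
  rewrite big1 ?addr0 => [->//|i ik].
  by rewrite (inj_eq val_inj) eq_sym (negPf ik) mulr0.
have xc : gen_ideal [:: f; gmon R 0 1] (gmon R c 0).
  have f01 i j : (i < c)%N -> (j < 1)%N -> f i j = 0.
    by case: j => // ic _; apply: f0.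
  have E := split_box f01.
  set U := Germ2 (convergent2_xshift c f) in E; set V := Germ2 _ in E.
  have Uu : U \is a GRing.unit by rewrite germ2_unitE /at0 /= add0n.
  have -> : gmon R c 0 = U^-1 * (f - gmon R 0 1 * V).
    by rewrite E addrK mulrC mulrK.
  by apply/gen_ideal2P; exists U^-1, (- U^-1 * V); ring.
exists (fun i => g i 0%N).
rewrite (@split_box R c 1 (_ - _)) => [|i [|//] ic _]; last first.
  rewrite germ2_coefB coef (bigD1 (Ordinal ic)) //= !eqxx mulr1 big1 ?addr0 ?subrr // => k ki.
  rewrite (_ : (_ == _) = false) ?mulr0 //.
  by apply: contraNF ki => /eqP ik; apply/eqP/val_inj.
apply: gen_idealD; rewrite mulrC; apply: gen_idealMl => //.
by apply: gen_ideal_mem; rewrite !inE eqxx orbT.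
Qed.

End IntersectionWithLine.

(** * Newton polygon of a branch with one Puiseux pair *)

Section NewtonPolygon.
Variable R : realType.
Local Notation C := R[i].
Implicit Types f g h : germ2 R.

Lemma irreducible_initial f p q : (0 < p)%N -> (0 < q)%N -> irreducible_elt f ->
  exists i0 a, [/\ f i0 a != 0, vanish p q (p * i0 + q * a) f & i0 = 0%N \/ a = 0%N].
Proof.
move=> p0 q0 irr; have [f0 _ _] := irr.
pose Pw w := `[< exists i j, f i j != 0 /\ (p * i + q * j)%N = w >].
have exw : exists w, Pw w.
  apply: contrapT => H; case/eqP: f0; apply: germ2_eqP => i j.
  apply: contrapT => /eqP fij; apply: H; exists (p * i + q * j)%N.
  by apply/asboolP; exists i, j.
case: (ex_minnP exw) => W /asboolP[i1 [j1 [f1 e1]]] Wmin.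
pose Pj j := `[< exists i, f i j != 0 /\ (p * i + q * j)%N = W >].
have exj : exists j, Pj j by exists j1; apply/asboolP; exists i1.
case: (ex_minnP exj) => a /asboolP[i0 [c0 e0]] amin.
exists i0, a; split=> //.
  move=> i j; rewrite e0 => ij; apply/eqP; apply: contraLR ij => fij.
  by rewrite -leqNgt; apply: Wmin; apply/asboolP; exists i, j.
apply: (irreducible_face irr p0 q0 c0) => i j fij; rewrite e0.
  by apply: Wmin; apply/asboolP; exists i, j.
by move=> e; apply: amin; apply/asboolP; exists i.
Qed.

(** For the weights (n, c) some monomial of least weight is a pure power, and no pure power of
    weight below n c occurs in [f]. *)
Lemma irreducible_newton f n c : (0 < n)%N -> (0 < c)%N -> irreducible_elt f ->
  (forall j, (j < n)%N -> f 0%N j = 0) -> (forall i, (i < c)%N -> f i 0%N = 0) ->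
  vanish n c (n * c) f.
Proof.
move=> n0 c0 irr fy fx; have [i0 [a [fi0 v e]]] := irreducible_initial n0 c0 irr.
apply: vanish_le v; case: e fi0 => -> fi0.
  by rewrite muln0 add0n mulnC leq_mul2l leqNgt; apply/orP; right; apply/negP => /fy/eqP; apply/negP.
by rewrite muln0 addn0 leq_mul2l leqNgt; apply/orP; right; apply/negP => /fx/eqP; apply/negP.
Qed.

Lemma not_divides_gmon f i j : vanish 1 1 (i + j).+1 f -> ~ divides f (gmon R i j).
Proof.
move=> vf [h E]; have := gvanishMl h vf; rewrite -E => /(_ i j).
by rewrite !mul1n gmonE !eqxx => /(_ (ltnSn _))/eqP; rewrite oner_eq0.
Qed.

Lemma quot_dim_unit f h d : quot_dim (gen_ideal [:: f; h]) d -> h \is a GRing.unit -> d = 0%N.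
Proof.
move=> Hd hu; apply/eqP; rewrite -leqn0.
apply: (quot_dim_le_size (gen_ideal_lin [:: f; h]) Hd (s := [::])) => g.
apply: (inspan_mod _ (gen_ideal_lin _)); apply/gen_ideal2P; exists 0, (g * h^-1).
by rewrite mul0r add0r mulrVK.
Qed.

Section Branch.
Variables n m mu tau : nat.

(** The state of the coordinate change: the Newton polygon ends at (0, n) and (c, 0), and [c] is to
    be raised to [m]. *)
Definition reduced f c : Prop :=
  [/\ branch_data f n m mu tau, vanish 1 1 2 f,
      (forall j, (j < n)%N -> f 0%N j = 0) /\ f 0%N n != 0 &
      (forall i, (i < c)%N -> f i 0%N = 0) /\ f c 0%N != 0].

(** Otherwise y divides [f], and the cofactor is not a unit since its constant term is the
    coefficient of y. *)
Lemma irreducible_x_term f : irreducible_elt f -> f 0%N 1%N = 0 ->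
  exists i, f i 0%N != 0.
Proof.
move=> [_ _ irr] f1; apply: contrapT => H.
have fx i : f i 0%N = 0 by apply: contrapT => /eqP fi; apply: H; exists i.
have cV : (fun i j => f i j.+1 : C) \in @convergent2 R.
  apply: (@convergent2_dom _ f _ 1 (germ2P f)) => i j; right.
  by exists i, j.+1; split=> //; rewrite addn1 addnS.
have E : f = gmon R 0 1 * Germ2 cV.
  by apply: germ2_eqP => i [|j]; rewrite gmon_mulE /= ?fx // subn0 subn1.
by have [] := irr _ _ E; rewrite germ2_unitE /at0 /= ?f1 eqxx.
Qed.

Lemma reduced_extend f c : branch_data f n m mu tau -> vanish 1 1 2 f ->
  (forall j, (j < n)%N -> f 0%N j = 0) -> f 0%N n != 0 ->
  (forall i, (i < c)%N -> f i 0%N = 0) ->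
  exists2 c', (c <= c')%N & reduced f c'.
Proof.
move=> D v fy fn fx; have [irr _ _ _] := D.
have exi := irreducible_x_term irr (v 0%N 1%N isT).
case: (ex_minnP exi) => c' fc' cmin; exists c'.
  by rewrite leqNgt; apply/negP => /fx/eqP; apply/negP.
split=> //; split=> // i ic; apply/eqP; apply: contraLR ic => fi.
by rewrite -leqNgt; apply: cmin.
Qed.

Lemma semigroup_branch f : branch_data f n m mu tau ->
  [/\ (1 < n)%N, (n < m)%N, coprime n m &
  forall k, semigroup_of f k <-> exists u v, k = (u * n + v * m)%N].
Proof.
move=> [_ [/andP[n1 nm] co sg] _ _]; split=> // k; by rewrite sg.
Qed.

(** A germ of value [n] > 0 is not a unit, and the value of a non-unit is at least the order [e].
    Conversely [e] is the value of x, and positive elements of the semigroup are at least [n]. *)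
Lemma order_branch f e : branch_data f n m mu tau -> vanish 1 1 2 f ->
  vanish 1 1 e f -> f 0%N e != 0 -> e = n.
Proof.
move=> D v2 ve fe; have [n1 nm co sg] := semigroup_branch D.
apply/eqP; rewrite eqn_leq; apply/andP; split.
  have [h nd Hn] : semigroup_of f n by apply/sg; exists 1%N, 0%N; rewrite mul1n addn0.
  apply: (@quot_dim_ge_edge 1 1 _ _ R f h e n e) => // [i j|i ie]; last by rewrite mul1n.
  rewrite !mul1n ltnS leqn0 addn_eq0 => /andP[/eqP-> /eqP->]; apply/eqP.
  apply: contraTT n1 => h0; rewrite -leqNgt.
  by rewrite (quot_dim_unit Hn) // germ2_unitE.
have He : quot_dim (gen_ideal [:: f; gmon R 1 0]) e.
  have Hs : quot_dim (gen_ideal [:: gswap f; gmon R 0 1]) e.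
    by apply: quot_dim_line => // i ie; rewrite gswapE ve // !mul1n add0n.
  have := iso_quot_dim (gswap_iso R) Hs; rewrite /= (isoK (gswap_iso R)).
  have -> // : gswap (gmon R 0 1) = gmon R 1 0.
  by apply: germ2_eqP => i j; rewrite gswapE !gmonE andbC.
have /sg[u [w eE]] : semigroup_of f e.
  by exists (gmon R 1 0) => //; apply: not_divides_gmon.
have e0 : (0 < e)%N.
  by rewrite lt0n; apply: contra fe => /eqP->; rewrite v2.
case: u eE => [|u] eE; last by rewrite eE mulSn -addnA leq_addr.
case: w eE => [|w] eE; first by rewrite eE in e0.
by rewrite eE mul0n add0n mulSn (leq_trans (ltnW nm)) ?leq_addr.
Qed.

Lemma reduced_exists f : plane_branch f -> branch_data f n m mu tau ->
  exists g c, reduced g c.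
Proof.
move=> [f00 f10 f01 irr] D.
have v2 : vanish 1 1 2 f.
  by move=> [|[|i]] [|[|j]].
have fin g e : branch_data g n m mu tau -> vanish 1 1 2 g -> vanish 1 1 e g ->
    g 0%N e != 0 -> exists g c, reduced g c.
  move=> Dg vg ve ge; have en := order_branch Dg vg ve ge.
  have [|||c _ Hc] := @reduced_extend g 0 Dg vg _ _ _; last by exists g, c.
  - by move=> j jn; rewrite ve // !mul1n add0n en.
  - by rewrite -en.
  - by [].
have [i0 [a [c0 ve e]]] := @irreducible_initial f 1 1 isT isT irr.
move: ve; rewrite !mul1n => ve.
case: e c0 ve => -> c0 ve; first exact: fin D v2 ve c0.
rewrite addn0 in ve.
have sw k g : vanish 1 1 k (germ2_fps g) -> vanish 1 1 k (germ2_fps (gswap g)).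
  by move=> vg i j ij; rewrite gswapE vg // addnC.
(* The pure power in the initial form is one of x, so the coordinates are exchanged. *)
exact: fin (branch_data_swap D) (sw _ _ v2) (sw _ _ ve) c0.
Qed.

Lemma reduced_step f c : reduced f c -> (c < m)%N ->
  exists g c', (c < c')%N /\ reduced g c'.
Proof.
move=> [D v2 [fy fn] [fx fc]] cm; have [n1 nm co sg] := semigroup_branch D.
have [irr _ _ _] := D.
have c0 : (0 < c)%N by rewrite lt0n; apply: contra fc => /eqP->; rewrite v2.
have n0 : (0 < n)%N by apply: ltnW.
(* The value of y is [c], and the elements of the semigroup below [m] are multiples of [n]; so the
   edge has the integral slope needed for the substitution. *)
have /sg[k [v cE]] : semigroup_of f c.
  exists (gmon R 0 1); first exact: not_divides_gmon.
  exact: quot_dim_line.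
case: v cE => [|v] cE; last by move: cm; rewrite cE mulSn addnCA ltnNge leq_addr.
rewrite mul0n addn0 in cE.
have k0 : (0 < k)%N by move: c0; rewrite cE muln_gt0 => /andP[].
have vf i j : (i + k * j < k * n)%N -> f i j = 0.
  move=> ij; apply: (irreducible_newton n0 c0 irr fy fx).
  by rewrite cE (mulnC k n) -mulnA -mulnDr ltn_pmul2l // (mulnC n).
(* [P] is the polynomial of the edge of slope [k]; substituting [y + al x^k] for
   [y], with [al] one of its roots, kills the term [x^c]. *)
pose P : {poly C} := \poly_(j < n.+1) f (k * (n - j))%N j.
have sP : size P = n.+1 by apply: size_poly_eq; rewrite subnn muln0.
have [al rt] : exists al, root P al.
  by apply/closed_rootP; rewrite sP; case: (n) n0.
have gx i : (i < c.+1)%N -> gshift k0 al f i 0%N = 0.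
  rewrite ltnS => ic; rewrite (@gshiftE _ _ _ al f i.+1) //.
  have [ilt|ige] := ltnP i c.
    rewrite big1 // => t _; case: ifP => // kt; rewrite vf ?mul0r ?mul0rn //.
    by rewrite add0n subnK // (leq_trans ilt) // cE mulnC.
  have iE : i = (k * n)%N by apply/eqP; rewrite -cE eqn_leq ic ige.
  have nN : (n.+1 <= i.+1)%N by rewrite ltnS iE leq_pmull.
  move/rootP: rt => rt; transitivity P.[al]; last exact: rt.
  rewrite horner_poly.
  rewrite [RHS](big_ord_widen _ (fun j : nat => f (k * (n - j))%N j * al ^+ j) nN).
  rewrite [RHS]big_mkcond; apply: eq_bigr => -[t /= _] _.
  rewrite iE leq_pmul2l // add0n binn mulr1n -mulnBr.
  by rewrite ltnS.
have gy j : gshift k0 al f 0%N j = f 0%N j.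
  rewrite (@gshiftE _ _ _ al f 1) // big_ord1 muln0 /= subn0 addn0 bin0.
  by rewrite expr0 mulr1.
have [|||c' cc' Hc'] := @reduced_extend (gshift k0 al f) c.+1 (branch_data_shift k0 al D) (gshift_vanish k0 al v2).
- by move=> j jn; rewrite gy fy.
- by rewrite gy.
- exact: gx.
by exists (gshift k0 al f), c'.
Qed.

Lemma reduced_climb f c : reduced f c -> exists g c', (m <= c')%N /\ reduced g c'.
Proof.
move: {2}(m - c)%N (leqnn (m - c)) => N; elim: N f c => [|N IH] f c mc Hf.
  by exists f, c; split=> //; rewrite -subn_eq0 -leqn0.
have [le|lt] := leqP m c; first by exists f, c.
have [g [c' [cc' Hg]]] := reduced_step Hf lt.
by apply: IH Hg; lia.
Qed.

(** Let [h] have value [m]. Either [h] has at least the weight of y for the weights (n, c), and its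
    value is at least [c]; or a term x^i0 dominates in [h], and its value is [i0 * n], against
    coprimality. *)
Lemma reduced_eq f c : reduced f c -> (m <= c)%N -> c = m.
Proof.
move=> [D v2 [fy fn] [fx fc]] mc; have [n1 nm co sg] := semigroup_branch D.
have [irr _ _ _] := D.
have n0 : (0 < n)%N by apply: ltnW.
have c0 : (0 < c)%N by apply: leq_trans mc; apply: leq_trans nm.
have vf := irreducible_newton n0 c0 irr fy fx.
have [h nd Hm] : semigroup_of f m by apply/sg; exists 0%N, 1%N; rewrite mul1n.
have [vh|nvh] := pselect (vanish n c c h).
  apply/eqP; rewrite eqn_leq mc andbT.
  by apply: (quot_dim_ge_edge n0 c0 vf vh Hm) => i ic; rewrite ltn_pmul2l.
exfalso.
have exi : exists i, (n * i < c)%N && (h i 0%N != 0).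
  apply: contrapT => H; apply: nvh => i [|j] ij.
    apply: contrapT => /eqP hi; apply: H; exists i.
    by rewrite hi andbT; move: ij; rewrite muln0 addn0.
  by move: ij; rewrite mulnS addnCA ltnNge leq_addr.
case: (ex_minnP exi) => i0 /andP[ni0 hi0] imin.
have HI : quot_dim (gen_ideal [:: h; f]) m.
  apply: quot_dim_ext Hm => g; rewrite !gen_ideal2P.
  by split=> -[u [v ->]]; exists v, u; rewrite addrC.
(* For the weights [(2 n, 2 c - 1)], just below the slope of the edge, the leading
   terms of [h] and [f] are the pure powers [x^i0] and [y^n]. *)
have q0 : (0 < 2 * c - 1)%N by lia.
have p0 : (0 < 2 * n)%N by lia.
have mE : m = (i0 * n)%N.
  apply: (quot_dim_box p0 q0 hi0 fn _ _ HI) => i j ij; rewrite germ2_coefB germ2_coefZ gmonE.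
    case: j ij => [|j] ij; last first.
      exfalso; move: ij; rewrite mulnS ltnS leqNgt => /negP; apply.
      by rewrite -mulnA; move: ni0; set x := (n * i0)%N; lia.
    rewrite muln0 addn0 ltnS leq_pmul2l // in ij.
    have [->|ne] := eqVneq i i0; first by rewrite mulr1 subrr.
    rewrite mulr0 subr0; apply/eqP; apply: contraNT ne => hi.
    rewrite eqn_leq ij imin // hi andbT.
    by apply: leq_ltn_trans ni0; rewrite leq_pmul2l.
  have [nij|nij] := ltnP (n * i + c * j) (n * c).
    rewrite vf //; case: andP => [[/eqP ei /eqP ej]|_]; last by rewrite mulr0 subrr.
    by move: nij; rewrite ei ej muln0 add0n mulnC ltnn.
  (* Comparing the tilted inequality with twice that of the edge gives j >= n; then 2 n i + (2 c -
     1)(j - n) <= 0 forces i = 0 and j = n. *)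
  suff [-> ->] : i = 0%N /\ j = n by rewrite !eqxx mulr1 subrr.
  move: ij nij; rewrite ltnS !mulnBl !mul1n -!mulnA.
  have cj : (j <= c * j)%N by rewrite leq_pmull.
  have cn : (n <= c * n)%N by rewrite leq_pmull.
  rewrite (mulnC n c) => ij nij.
  have jn : (n <= j)%N by lia.
  have : (c * n <= c * j)%N by rewrite leq_mul2l jn orbT.
  have : (c.-1 * n <= c.-1 * j)%N by rewrite leq_mul2l jn orbT.
  have cE x : (c * x = c.-1 * x + x)%N by rewrite -{1}(prednK c0) mulSn addnC.
  have i0' : (i = 0 \/ n <= n * i)%N.
    by case: (i) => [|i']; [left|right; rewrite leq_pmulr].
  move=> h1 h2; rewrite !cE in ij nij h2; split; last by lia.
  by case: i0' => // ?; lia.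
move: co; rewrite /coprime mE gcdnMl => /eqP nE.
by rewrite nE in n1.
Qed.

Lemma branch_normal_form f : plane_branch f -> branch_data f n m mu tau ->
  exists g, [/\ branch_data g n m mu tau, vanish n m (n * m) g,
    g 0%N n != 0 & g m 0%N != 0].
Proof.
move=> Hf D; have [g [c Hg]] := reduced_exists Hf D.
have {g c Hg}[g [c [mc Hg]]] := reduced_climb Hg.
have cm := reduced_eq Hg mc; rewrite {c mc}cm in Hg.
have [Dg _ [fy fn] [fx fc]] := Hg; have [n1 nm _ _] := semigroup_branch Dg.
exists g; split=> //; apply: irreducible_newton => //; try lia.
by case: Dg.
Qed.

End Branch.
End NewtonPolygon.

(** * Lattice points and the final estimate *)

Section LatticePoints.
Variables n m : nat.
Hypotheses (n1 : (1 < n)%N) (nm : (n < m)%N).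

(** The set H, with (a, b) encoded by the exponents (a - 1, b - 1). *)
Definition half_box : seq (nat * nat) :=
  [seq u <- pair_box m.-1 n.-1 | (2 * (n * u.1.+1 + m * u.2.+1) < n * m)%N].

Lemma mem_half_box (u : nat * nat) : (u \in half_box) = (2 * (n * u.1.+1 + m * u.2.+1) < n * m)%N.
Proof.
rewrite mem_filter mem_pair_box; case: ltnP => // lt /=; apply/andP; split.
  suff : (u.1.+1 < m)%N by lia.
  rewrite -(@ltn_pmul2l n); last by lia.
  by move: lt; set x := (n * _)%N; set y := (m * _)%N; lia.
suff : (u.2.+1 < n)%N by lia.
rewrite -(@ltn_pmul2l m); last by lia.
by move: lt; rewrite (mulnC n m); set x := (n * _)%N; set y := (m * _.+1)%N; lia.
Qed.

Lemma uniq_half_box : uniq half_box.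
Proof. by rewrite filter_uniq ?uniq_pair_box. Qed.

(* [half_box] and its mirror image in the box [A x B] are disjoint; when [n]
   and [m] are odd, they moreover miss a point of the top row. *)
Lemma half_box_lt : (8 * size half_box < n.-1 * m.-1)%N.
Proof.
pose A := m.-1./2; pose B := n.-1./2.
have A2 : (A.*2 + odd m.-1 = m.-1)%N by rewrite addnC odd_double_half.
have B2 : (B.*2 + odd n.-1 = n.-1)%N by rewrite addnC odd_double_half.
have Am : (m <= 2 * A.+1)%N by case: (odd _) A2; lia.
have Bn : (n <= 2 * B.+1)%N by case: (odd _) B2; lia.
have inAB (u : nat * nat) : u \in half_box -> (u.1 < A)%N /\ (u.2 < B)%N.
  rewrite mem_half_box => lt; split.
    have : (2 * u.1.+1 < m)%N.
      rewrite -(@ltn_pmul2l n); last by lia.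
      by move: lt; rewrite (mulnCA n 2); set x := (n * _.+1)%N; set y := (m * _)%N; lia.
    by case: (odd _) A2; lia.
  have : (2 * u.2.+1 < n)%N.
    rewrite -(@ltn_pmul2l m); last by lia.
    move: lt; rewrite (mulnCA m 2) (mulnC n m).
    by set x := (n * _)%N; set y := (m * _.+1)%N; lia.
  by case: (odd _) B2; lia.
pose mir (u : nat * nat) := (A.-1 - u.1, B.-1 - u.2)%N.
have mirK (u : nat * nat) : (u.1 < A)%N -> (u.2 < B)%N -> mir (mir u) = u.
  by case: u => i j /= iA jB; rewrite /mir /=; congr (_, _); lia.
have umir : uniq (map mir half_box).
  rewrite map_inj_in_uniq ?uniq_half_box // => u v /inAB[u1 u2] /inAB[v1 v2] e.
  by rewrite -[u]mirK // e mirK.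
(* The shifted weights of a point and its mirror image add up to n (A + 1) + m (B + 1) >= n m, too
   much for two numbers below n m / 2. *)
have disj (u : nat * nat) : u \in half_box -> mir u \notin half_box.
  move=> uH; have [u1 u2] := inAB _ uH; apply/negP.
  move: uH; rewrite !mem_half_box /mir /=; case: u u1 u2 => i j /= iA jB.
  have -> : ((A.-1 - i).+1 = A - i)%N by lia.
  have -> : ((B.-1 - j).+1 = B - j)%N by lia.
  move=> h1 h2; have : (n * m <= 2 * (n * A.+1))%N by rewrite mulnCA leq_mul2l Am orbT.
  have : (n * m <= 2 * (m * B.+1))%N by rewrite mulnC mulnCA leq_mul2l Bn orbT.
  have -> : (A.+1 = i.+1 + (A - i))%N by lia.
  have -> : (B.+1 = j.+1 + (B - j))%N by lia.
  by rewrite !mulnDr; lia.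
have uni : uniq (half_box ++ map mir half_box).
  rewrite cat_uniq uniq_half_box umir andbT /=; apply/hasPn => _ /mapP[u uH ->].
  exact: disj.
have sub : {subset half_box ++ map mir half_box <= pair_box A B}.
  move=> u; rewrite mem_cat mem_pair_box => /orP[/inAB[-> ->]//|/mapP[v /inAB[v1 v2] ->]].
  by rewrite /mir /=; lia.
have le := uniq_leq_size uni sub; rewrite size_cat size_map size_pair_box in le.
have oddP x : (0 < x)%N -> odd x = ~~ odd x.-1 by case: x.
(* If [n] or [m] is even, halving already loses enough for strictness. If both are odd, 4 A B equals
   (n - 1)(m - 1) and a missed point is required. *)
have [/andP[om on]|even] := boolP (odd m && odd n); last first.
  have lt : (4 * (A * B) < n.-1 * m.-1)%N.
    have [om|om] := boolP (odd m.-1).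
      have -> : m.-1 = A.*2.+1 by rewrite -A2 om addn1.
      have : (B.*2 <= n.-1)%N by rewrite -B2 leq_addr.
      by rewrite mulnS -mul2n -mul2n => hB; nia.
    have on : odd n.-1 by move: even; rewrite (oddP n) ?(oddP m) ?om ?negbK //; lia.
    have -> : n.-1 = B.*2.+1 by rewrite -B2 on addn1.
    have : (A.*2 <= m.-1)%N by rewrite -A2 leq_addr.
    by rewrite -!mul2n => hA; nia.
  apply: leq_ltn_trans lt; rewrite -[8%N]/(4 * 2)%N -mulnA leq_mul2l /= mul2n -addnn.
  exact: le.
have om' : odd m.-1 = false by apply/negbTE; rewrite -oddP //; lia.
have on' : odd n.-1 = false by apply/negbTE; rewrite -oddP //; lia.
rewrite om' addn0 in A2; rewrite on' addn0 in B2.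
have mA : (m = 2 * A + 1)%N by rewrite -mul2n in A2; lia.
have nB : (n = 2 * B + 1)%N by rewrite -mul2n in B2; lia.
(* The least abscissa on the top row outside [half_box]; that its mirror image on the bottom row is
   outside as well follows from n < m. *)
pose a := ((m - 1) %/ (2 * n))%N.
have a1 : (2 * n * a <= m - 1)%N by rewrite mulnC leq_trunc_div.
have a2 : (m - 1 < 2 * n * a.+1)%N by rewrite mulnC ltn_ceil // muln_gt0 /= ltnW.
have B0 : (0 < B)%N by lia.
have aA : (a < A)%N.
  rewrite -(@ltn_pmul2l (2 * n)); last by lia.
  by apply: leq_ltn_trans a1 _; nia.
pose pt := (a, B.-1).
have ptH : pt \notin half_box.
  rewrite mem_half_box /= prednK // -leqNgt.
  have -> : (n * m = m + m * (2 * B))%N by rewrite {1}nB; ring.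
  by move: a2; rewrite mulnDr -(mulnA 2) !(mulnCA 2); lia.
have ptM : mir pt \notin half_box.
  rewrite mem_half_box /mir /= subnn -leqNgt.
  have -> : ((A.-1 - a).+1 = A - a)%N by lia.
  have -> : (n * m = n + n * (2 * A))%N by rewrite {1}mA; ring.
  have : (n * a + n * (A - a) = n * A)%N by rewrite -mulnDr subnKC // ltnW.
  by move: a1; rewrite -mulnA mulnDr muln1 !(mulnCA _ 2); lia.
have uni' : uniq (pt :: half_box ++ map mir half_box).
  rewrite cons_uniq uni andbT mem_cat negb_or ptH /=; apply/mapP => -[u uH e].
  have [u1 u2] := inAB _ uH; case/negP: ptM.
  by rewrite e mirK.
have sub' : {subset pt :: half_box ++ map mir half_box <= pair_box A B}.
  move=> u; rewrite inE => /orP[/eqP->|]; last exact: sub.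
  by rewrite mem_pair_box /= aA prednK // leqnn.
have := uniq_leq_size uni' sub'; rewrite /= size_cat size_map size_pair_box.
rewrite -A2 -B2 -!mul2n => lt.
apply: (@leq_trans (4 * (A * B))%N); last by nia.
rewrite -[8%N]/(4 * 2)%N -mulnA ltn_mul2l /= mul2n -addnn; exact: lt.
Qed.

(** The balance point: after shifting exponents by one, weight below [k] becomes weight below n m /
    2, and so does weight above k + n m after the reflection (i, j) -> (m - 2 - i, n - 2 - j).
    Rounding up is harmless, as an integer lies below the rounded half exactly if its double lies
    below n m. When n m / 2 < n + m, truncation gives k = 0, where the triangle is empty. *)
Let k := ((n * m).+1./2 - (n + m))%N.

Lemma half_round : (n * m <= 2 * (n * m).+1./2 <= (n * m).+1)%N.
Proof.
rewrite mul2n; have := odd_double_half (n * m).+1.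
by case: (odd _); set t := (_./2).*2; lia.
Qed.

Lemma triangle_le_half : (size (triangle n m k) <= size half_box)%N.
Proof.
apply: uniq_leq_size => [|[i j]]; first exact: uniq_triangle.
rewrite mem_triangle ?mem_half_box /=; [|lia|lia].
have := half_round; rewrite /k !mulnS; set t := _./2.
by set x := (n * i)%N; set y := (m * j)%N; lia.
Qed.

Lemma count_high_le_half :
  (count (fun u => k + n * m < n * u.1 + m * u.2)%N (pair_box m.-1 n.-1) <= size half_box)%N.
Proof.
pose mir (u : nat * nat) := (m.-2 - u.1, n.-2 - u.2)%N.
rewrite -size_filter -(size_map mir); apply: uniq_leq_size.
  rewrite map_inj_in_uniq ?filter_uniq ?uniq_pair_box // => -[i j] [i' j'].
  rewrite !mem_filter !mem_pair_box /= => /andP[_ /andP[? ?]] /andP[_ /andP[? ?]].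
  by rewrite /mir /= => -[? ?]; congr (_, _); lia.
move=> _ /mapP[[i j] + ->]; rewrite mem_filter mem_pair_box mem_half_box /mir /=.
move=> /andP[lt /andP[im jn]].
have e1 : (n * (m.-2 - i).+1 + n * i.+1 = n * m)%N by rewrite -mulnDr; congr (_ * _)%N; lia.
have e2 : (m * (n.-2 - j).+1 + m * j.+1 = n * m)%N by rewrite -mulnDr mulnC; congr (_ * _)%N; lia.
move: lt e1 e2; have := half_round; rewrite /k !(mulnS _ i) !(mulnS _ j); set t := _./2.
set x := (n * i)%N; set y := (m * j)%N; set z := (n * _.+1)%N; set w := (m * _.+1)%N.
by lia.
Qed.

Lemma half_box_bound tau :
  (n.-1 * m.-1 <= tau + size (triangle n m k) +
     count (fun u => k + n * m < n * u.1 + m * u.2)%N (pair_box m.-1 n.-1))%N ->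
  (3 * (n.-1 * m.-1) < 4 * tau)%N.
Proof.
have := half_box_lt; have := triangle_le_half; have := count_high_le_half.
lia.
Qed.

End LatticePoints.

(** * Germs with initial form a y^n + b x^m *)

Section SemiQuasihomogeneous.
Variables (R : realType) (n m : nat) (f : germ2 R).
Hypotheses (n1 : (1 < n)%N) (nm : (n < m)%N) (co : coprime n m).
Hypotheses (vf : vanish n m (n * m) f) (fn : f 0%N n != 0) (fm : f m 0%N != 0).

(** Coprimality: [m] divides n a, hence a, so the edge carries no lattice point but its ends. *)
Lemma edge_lattice a b : (n * a + m * b = n * m)%N ->
  (a = m /\ b = 0%N) \/ (a = 0%N /\ b = n).
Proof.
move=> e; have ma : (m %| n * a)%N.
  by rewrite -(dvdn_addl _ (dvdn_mulr b (dvdnn m))) e dvdn_mull.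
rewrite Gauss_dvdr 1?coprime_sym // in ma.
case/dvdnP: ma => [[|c] ae].
  right; split=> //; apply/eqP; rewrite -(@eqn_pmul2l m); last by lia.
  by move/eqP: e; rewrite ae mul0n muln0 add0n (mulnC n).
have /eqP : (n * (c * m) + m * b = 0)%N by move: e; rewrite ae mulSn mulnDr; lia.
rewrite addn_eq0 !muln_eq0 => /andP[hc hb].
have c0 : c = 0%N by lia.
by left; split; [rewrite ae c0 mul1n|lia].
Qed.

(** Of the two monomials of weight n m, only x^m survives differentiation in x; this gives the
    pure-power initial form that the dimension bounds require. *)
Lemma vanish_dx : vanish n m (n * m.-1).+1 (dx f - (f m 0%N *+ m) *: gmon R m.-1 0).
Proof.
move=> i j ij; rewrite germ2_coefB germ2_coefZ dxE gmonE.
have mE : m = m.-1.+1 by rewrite prednK //; lia.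
have [e|ne] := eqVneq (n * i.+1 + m * j)%N (n * m)%N.
  case: (edge_lattice e) => [[ei ->]|[]//].
  have -> : i = m.-1 by rewrite -ei.
  by rewrite -mE !eqxx mulr1 subrr.
rewrite vf ?mul0rn ?sub0r; last by move: ij ne; rewrite {2 3}mE !mulnS; lia.
case: andP => [[/eqP ei /eqP ej]|_]; last by rewrite mulr0 oppr0.
by case/eqP: ne; rewrite ei ej -mE muln0 addn0.
Qed.

Lemma vanish_dy : vanish n m (m * n.-1).+1 (dy f - (f 0%N n *+ n) *: gmon R 0 n.-1).
Proof.
move=> i j ij; rewrite germ2_coefB germ2_coefZ dyE gmonE.
have nE : n = n.-1.+1 by rewrite prednK //; lia.
have [e|ne] := eqVneq (n * i + m * j.+1)%N (n * m)%N.
  case: (edge_lattice e) => [[]//|[-> ej]].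
  have -> : j = n.-1 by rewrite -ej.
  by rewrite -nE !eqxx mulr1 subrr.
rewrite vf ?mul0rn ?sub0r; last first.
  by move: ij ne; rewrite (mulnC n m) {3 4}nE !mulnS; lia.
case: andP => [[/eqP ei /eqP ej]|_]; last by rewrite mulr0 oppr0.
by case/eqP: ne; rewrite ei ej -nE muln0 add0n mulnC.
Qed.

(** The operator n x d/dx + m y d/dy multiplies each monomial by its weight, so divided by n m it
    fixes the part of weight n m. *)
Lemma euler_mod : exists2 g, gen_ideal [:: dx f; dy f] g &
  vanish n m (n * m).+1 (f - g).
Proof.
pose N : R[i] := (n * m)%:R.
have N0 : N != 0 by rewrite pnatr_eq0 muln_eq0; lia.
exists ((N^-1 * n%:R) *: gmon R 1 0 * dx f + (N^-1 * m%:R) *: gmon R 0 1 * dy f).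
  by apply/gen_ideal2P; do 2!eexists.
have xE i j : (gmon R 1 0 * dx f) i j = f i j * i%:R.
  rewrite gmon_mulE andbT; case: i => [|i]; first by rewrite mulr0.
  by rewrite ltn0Sn subn1 subn0 dxE mulr_natr.
have yE i j : (gmon R 0 1 * dy f) i j = f i j * j%:R.
  rewrite gmon_mulE leq0n; case: j => [|j]; first by rewrite mulr0.
  by rewrite ltn0Sn subn1 subn0 dyE mulr_natr.
move=> i j; rewrite ltnS leq_eqVlt => /orP[/eqP e|lt].
  rewrite germ2_coefB germ2_coefD -!scalerAl !germ2_coefZ xE yE.
  have -> : N^-1 * n%:R * (f i j * i%:R) + N^-1 * m%:R * (f i j * j%:R) =
      f i j * (N^-1 * (n%:R * i%:R + m%:R * j%:R)) by ring.
  by rewrite -!natrM -natrD e mulVf // mulr1 subrr.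
rewrite germ2_coefB germ2_coefD -!scalerAl !germ2_coefZ xE yE vf //.
by rewrite !mul0r !mulr0 addr0 subrr.
Qed.

Lemma tjurina_milnor_bound mu tau :
  milnor_number f mu -> tjurina_number f tau -> (3 * mu < 4 * tau)%N.
Proof.
move=> Hmu Htau.
have n0 : (0 < n)%N by lia.
have m0 : (0 < m)%N by lia.
have lu0 : f m 0%N *+ m != 0 by rewrite mulrn_eq0 negb_or fm; lia.
have lv0 : f 0%N n *+ n != 0 by rewrite mulrn_eq0 negb_or fn; lia.
have le := quot_dim_le_box n0 m0 lu0 lv0 vanish_dx vanish_dy Hmu.
have := quot_dim_ge_box n0 m0 lu0 lv0 vanish_dx vanish_dy
  ((n * m).+1./2 - (n + m)) euler_mod Htau.
rewrite mulnC => /(half_box_bound n1 nm); lia.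
Qed.

End SemiQuasihomogeneous.

Theorem proposition1 (R : realType) (f : germ2 R) (n m mu tau : nat)
    (hf : plane_branch f)
    (hpair : single_puiseux_pair f n m)
    (hmu : milnor_number f mu)
    (htau : tjurina_number f tau) :
  (mu%:R / tau%:R : rat) < 4%:R / 3%:R.
Proof.
have irr : irreducible_elt f by case: hf.
have [g [Dg vg gn gm]] := branch_normal_form hf (And4 irr hpair hmu htau).
have [n1 nm co _] := semigroup_branch Dg; have [_ _ gmu gtau] := Dg.
have H := tjurina_milnor_bound n1 nm co vg gn gm gmu gtau.
(* Strictness of [H] excludes [tau = 0], where the quotient would be the default value 0. *)
have tau0 : (0 < tau)%N by lia.
rewrite ltr_pdivrMr ?ltr0n // mulrAC ltr_pdivlMr ?ltr0n //.
by rewrite -!natrM ltr_nat mulnC.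
Qed.
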